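(* There exists a universal constant $C>0$ such that the following holds. Let $n=n(m)$ be even integers with $n\ge C\,m\log m$ and let $p=p(n)\in[0,1]$ be arbitrary. Let $A\in\{0,1\}^{m\times n}$ be a random matrix whose entries are i.i.d. Bernoulli random variables with parameter $p$. Then $\mathrm{disc}(A)\le 1$ with high probability, i.e. $\mathbb{P}[\mathrm{disc}(A)\le 1]\to 1$ as $m\to\infty$.
   Context: For a matrix $A\in\mathbb{R}^{m\times n}$, its discrepancy is $\mathrm{disc}(A)=\min_{u\in\{-1,+1\}^n}\|Au\|_\infty$. Asymptotics are as $m\to\infty$ (hence $n\to\infty$); $\log$ is the natural logarithm. ''Universal'' means that $C$ does not depend on $m,n,p$. *)

(* Defs.v *)
From mathcomp Require Export all_boot all_order all_algebra.
From mathcomp Require Export all_classical all_reals all_analysis.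

Set Implicit Arguments.
Unset Strict Implicit.
Unset Printing Implicit Defensive.

Export Order.TTheory GRing.Theory Num.Theory.
Export numFieldNormedType.Exports.

Local Open Scope classical_set_scope.
Local Open Scope ring_scope.

Definition sign_vectors (R : realType) (n : nat) : set 'cV[R]_n :=
  [set u | forall j, u j 0 = -1 \/ u j 0 = 1].
Arguments sign_vectors : clear implicits.

(* The library norm on matrices is the largest absolute value of an entry, so
   on column vectors it is the sup norm.  The infimum is over a finite nonempty
   set, hence a minimum: see disc_le and disc_attained. *)
Definition disc (R : realType) (m n : nat) (A : 'M[R]_(m, n)) : R :=
  inf [set `|A *m u| | u in sign_vectors R n].

Lemma disc_le (R : realType) (m n : nat) (A : 'M[R]_(m, n)) (u : 'cV[R]_n) :
  sign_vectors R n u -> disc A <= `|A *m u|.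
Proof.
move=> su; apply: ge_inf; last by exists u.
by exists 0 => _ [v _ <-]; exact: normr_ge0.
Qed.

Lemma disc_attained (R : realType) (m n : nat) (A : 'M[R]_(m, n)) :
  exists2 u, sign_vectors R n u & disc A = `|A *m u|.
Proof.
pose sg (b : {ffun 'I_n -> bool}) : 'cV[R]_n := \col_j (-1) ^+ b j.
have sgP b : sign_vectors R n (sg b).
  by move=> j; rewrite mxE; case: (b j); [left|right]; rewrite ?expr1 ?expr0.
pose b0 : {ffun 'I_n -> bool} := [ffun=> false].
case: (Order.TotalTheory.arg_minP (fun b => `|A *m sg b|) (isT : predT b0))
  => b _ bmin.
exists (sg b) => //; apply/eqP; rewrite eq_le disc_le //=.
apply: lb_le_inf; first by exists `|A *m sg b|, (sg b).
move=> _ [u su <-].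
have -> : u = sg [ffun j => u j 0 == -1].
  apply/matrixP => j k; rewrite ord1 !mxE ffunE.
  case: (su j) => ->; first by rewrite eqxx expr1.
  rewrite (_ : (1 == -1 :> R) = false) ?expr0 //.
  by rewrite -subr_eq0 opprK -(natrD _ 1 1) pnatr_eq0.
exact: bmin.
Qed.

Definition mutually_independent (d d' : measure_display)
    (T : measurableType d) (T' : measurableType d') (R : realType)
    (P : probability T R) (I : finType) (X : I -> {RV P >-> T'}) : Prop :=
  forall (S : {set I}) (B : I -> set T'), (forall i, measurable (B i)) ->
    P (\bigcap_(i in [set` S]) (X i @^-1` B i)) =
    (\prod_(i in S) P (X i @^-1` B i))%E.

Definition iid_bernoulli (d : measure_display) (T : measurableType d)
    (R : realType) (P : probability T R) (m n : nat) (p : R)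
    (X : 'I_m -> 'I_n -> {RV P >-> bool}) : Prop :=
  mutually_independent (fun ij : 'I_m * 'I_n => X ij.1 ij.2) /\
  forall i j, distribution P (X i j) =1 bernoulli_prob p.

Definition random_matrix (d : measure_display) (T : measurableType d)
    (R : realType) (P : probability T R) (m n : nat)
    (X : 'I_m -> 'I_n -> {RV P >-> bool}) (t : T) : 'M[R]_(m, n) :=
  \matrix_(i, j) (X i j t)%:R.

(* Main.v *)
(** Write n = 2N and give columns k and N + k opposite signs: the sums of a row are then
    those of a vector b with independent symmetric entries in {-1, 0, 1}, against x in
    {-1, 1}^N.  Given its support T, the row b satisfies |b x| <= 1 with a probability
    that does not depend on x; let psi be the indicator of this event divided by that
    probability, set to 0 when #|T| > 17N/32, and let Z be the average over x of the
    product of psi over the rows.  If Z > 0 then disc(A) <= 1, and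
    P(Z > 0) >= 2 E Z - E Z^2.  A Chernoff bound shows that E Z is close to 1.

    For E Z^2, the correlation of psi(b x) and psi(b y) depends only on z = x y, and by
    Fourier analysis on the cube it is at most 1 + sum_(2 <= j <= 17N/32) |kappa_j(z)|,
    where kappa_j is the normalized elementary symmetric polynomial: the Fourier
    coefficients of psi at sets of size j are normalized middle Krawtchouk numbers, whose
    square is at most 1 / 'C(#|T|, j) and which vanish at j = 1.  With S = sum_k z_k, the
    three term recurrence of kappa_j gives sum_j |kappa_j| <= 68 (S^2/N^2 + 1/N) as soon
    as |S| <= N/20.  The m-th power of this bound is integrated with the exponential
    moments of S^2, and the remaining z are exponentially rare.  Without the truncation
    the parity character kappa_N, of modulus 1, would spoil the estimate. *)

Require Import Defs.
From mathcomp Require Import ring lra zify.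

Set Implicit Arguments.
Unset Strict Implicit.
Unset Printing Implicit Defensive.

Local Open Scope classical_set_scope.
Local Open Scope ring_scope.

(** * Middle Krawtchouk coefficients *)

(** For [j <= 2h] and a fixed [j]-subset [U] of a [2h]-set, this is the sum of the character of [U]
    over the middle layer of the cube of dimension [2h]. *)
Definition kraw (R : realFieldType) (h j : nat) : R :=
  ((1 + 'X) ^+ (h.*2 - j) * (1 - 'X) ^+ j)`_h.

Lemma coef_addX_exp (R : nzRingType) n k : ((1 + 'X) ^+ n : {poly R})`_k = 'C(n, k)%:R.
Proof.
elim: n k => [|n IH] k; first by rewrite expr0 coef1; case: k.
rewrite exprS mulrDl mul1r coefD IH coefXM; case: k => [|k] /=.
  by rewrite addr0 !bin0.
by rewrite IH binS natrD.
Qed.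

Lemma kraw0 (R : realFieldType) h : kraw R h 0 = 'C(h.*2, h)%:R.
Proof. by rewrite /kraw expr0 mulr1 subn0 coef_addX_exp. Qed.

(* The coefficient of ['X^h] in ['X * F^`() - h *: F] vanishes; take
   [F = (1 + 'X) ^+ (2h - j - 1) * (1 - 'X) ^+ j.+1]. *)
Lemma kraw_rec (R : realFieldType) h j : (j.+2 <= h.*2)%N ->
  (h.*2 - j.+1)%:R * kraw R h j.+2 = - (j.+1%:R * kraw R h j).
Proof.
move=> lejh; set a := (h.*2 - j.+2)%N.
have E1 : (h.*2 - j.+1 = a.+1)%N by rewrite /a; lia.
have E0 : (h.*2 - j = a.+2)%N by rewrite /a; lia.
rewrite /kraw E1 E0 -/a.
set B : {poly R} := (1 + 'X) ^+ a * (1 - 'X) ^+ j.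
have -> : (1 + 'X) ^+ a * (1 - 'X) ^+ j.+2 = (1 - 'X) ^+ 2 * B.
  by rewrite /B -addn2 exprD; ring.
have -> : (1 + 'X) ^+ a.+2 * (1 - 'X) ^+ j = (1 + 'X) ^+ 2 * B.
  by rewrite /B -(addn2 a) exprD; ring.
pose F : {poly R} := (1 + 'X) ^+ a.+1 * (1 - 'X) ^+ j.+1.
have dF : F^`() = (a.+1%:R * (1 - 'X) - j.+1%:R * (1 + 'X)) * B.
  rewrite /F derivM !deriv_exp derivD derivB derivX -!polyC1 !derivC /B !exprS /= polyC1.
  rewrite -!(mulr_natl (_ * _)) add0r sub0r.
  move: ((1 + 'X) ^+ a) ((1 - 'X) ^+ j) (a.+1%:R) (j.+1%:R) => P Q u v.
  by move: ('X) => x; ring.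
have key : ('X * F^`() - h%:R * F)`_h = 0.
  rewrite coefB mulr_natl coefMn mulrC coefMX.
  case: (h) => [|h'] /=; first by rewrite mulr0n subr0.
  by rewrite coef_deriv subrr.
have hE : h%:R *+ 2 = a.+1%:R + j.+1%:R :> {poly R}.
  by rewrite -natrD -mulrnA muln2; congr (_%:R); rewrite /a; lia.
have : (a.+1%:R * ((1 - 'X) ^+ 2 * B) + j.+1%:R * ((1 + 'X) ^+ 2 * B))`_h = 0.
  have -> : a.+1%:R * ((1 - 'X) ^+ 2 * B) + j.+1%:R * ((1 + 'X) ^+ 2 * B) =
      - ('X * F^`() - h%:R * F) *+ 2.
    rewrite dF (_ : F = (1 + 'X) * (1 - 'X) * B); last first.
      rewrite /F /B !exprS; move: ((1 + 'X) ^+ a) ((1 - 'X) ^+ j) => P Q.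
      by move: ('X) => x; ring.
    move: hE; clear; move: B (h%:R) (a.+1%:R) (j.+1%:R) ('X) => {}B h' u v x hE.
    transitivity (- ((x * ((u * (1 - x) - v * (1 + x)) * B)) *+ 2
        - (h' *+ 2) * ((1 + x) * (1 - x) * B))); last by ring.
    by rewrite hE; ring.
  by rewrite coefMn coefN key oppr0 mul0rn.
rewrite coefD !mulr_natl !coefMn => /eqP; rewrite addr_eq0 => /eqP ->.
by [].
Qed.

(** The recurrence links indices of equal parity, and the value at 1 is
    ['C(2h - 1, h) - 'C(2h - 1, h - 1)]. The case [j = 1] later removes the linear term from the
    correlations. *)
Lemma kraw_odd (R : realFieldType) h i : (i.*2.+1 <= h.*2)%N -> kraw R h i.*2.+1 = 0.
Proof.
elim: i => [|i IH] lei.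
  have h0 : (0 < h)%N by lia.
  rewrite /kraw -(prednK h0) doubleS subn1 /= expr1 mulrBr mulr1 coefB coefMX /=.
  rewrite !coef_addX_exp -(@bin_sub h.-1.*2.+1 h.-1); last by lia.
  by rewrite (_ : (h.-1.*2.+1 - h.-1)%N = h.-1.+1) ?subrr //; lia.
have := @kraw_rec R h i.*2.+1; rewrite IH ?mulr0 ?oppr0 => [|]; last by lia.
have le : (i.*2.+3 <= h.*2)%N by lia.
move=> /(_ le) /eqP; rewrite mulf_eq0 pnatr_eq0 subn_eq0.
rewrite (_ : (h.*2 <= i.*2.+2)%N = false) /=; last by lia.
by move/eqP; rewrite doubleS.
Qed.

Lemma kraw_even (R : realFieldType) h i : (i <= h)%N ->
  'C(h.*2, i.*2)%:R * kraw R h i.*2 = (-1) ^+ i * 'C(h.*2, h)%:R * 'C(h, i)%:R.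
Proof.
elim: i => [|i IH] lei; first by rewrite kraw0 !bin0 expr0 mulr1 !mul1r.
have {}IH := IH (ltnW lei).
have le : (i.*2.+2 <= h.*2)%N by lia.
have rec := kraw_rec R le.
have b1 := mul_bin_left h.*2 i.*2.
have b2 := mul_bin_left h.*2 i.*2.+1.
have b3 := mul_bin_left h i.
have r1 := congr1 (fun k : nat => k%:R : R) b1.
have r2 := congr1 (fun k : nat => k%:R : R) b2.
have r3 := congr1 (fun k : nat => k%:R : R) b3.
rewrite /= !natrM in r1 r2 r3.
have d1 : (h.*2 - i.*2)%:R = 2 * (h - i)%:R :> R.
  by rewrite -(natrM _ 2); congr (_%:R); lia.
have d2 : (i.*2.+2)%:R = 2 * i.+1%:R :> R.
  by rewrite -(natrM _ 2); congr (_%:R); lia.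
rewrite d1 in r1; rewrite d2 in r2.
have nz1 : (h.*2 - i.*2.+1)%:R != 0 :> R by rewrite pnatr_eq0; lia.
have nz2 : i.*2.+1%:R != 0 :> R by rewrite pnatr_eq0.
have nz3 : i.+1%:R != 0 :> R by rewrite pnatr_eq0.
rewrite doubleS exprS.
move: rec r1 r2 r3 IH nz1 nz2 nz3.
move: (kraw R h i.*2.+2) (kraw R h i.*2) => x y.
move: ((h.*2 - i.*2.+1)%:R : R) (i.*2.+1%:R : R) (i.+1%:R : R) => u v w.
move: ((h - i)%:R : R) ('C(h.*2, i.*2.+2)%:R : R) ('C(h.*2, i.*2.+1)%:R : R).
move: ('C(h.*2, i.*2)%:R : R) ('C(h, i.+1)%:R : R) ('C(h, i)%:R : R) ('C(h.*2, h)%:R : R).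
move=> c0 d1' d0 e f c2 c1 rec r1 r2 r3 IH nzu nzv nzw.
(* Multiplying by the nonzero factors [w], [u], [v] and 2 lets the binomial ratios and the
   recurrence be applied without division. *)
apply: (mulfI nzw); apply: (mulfI nzu); apply: (mulfI nzv).
have r2' : w * c2 *+ 2 = u * c1 by rewrite -r2; ring.
apply: (@mulIf _ 2%:R) => //.
transitivity (v * (w * c2 *+ 2) * (u * x)); first by ring.
rewrite r2' rec.
transitivity (- u * (v * c1) * v * y); first by ring.
rewrite r1.
transitivity (- u * (2 * f) * v * (c0 * y)); first by ring.
rewrite IH.
transitivity (- 2 * u * v * (-1) ^+ i * e * (w * d1')); first by rewrite r3; ring.
by ring.
Qed.

(** The square is the middle term of the Vandermonde convolution of the right-hand side. *)
Lemma bin_sqr_le h i : ('C(h, i) ^ 2 <= 'C(h.*2, i.*2))%N.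
Proof.
rewrite -addnn -binomial.Vandermonde.
have lti : (i < i.*2.+1)%N by lia.
rewrite (bigD1 (Ordinal lti)) //= (_ : (i.*2 - i)%N = i) ?mulnn ?leq_addr //.
by lia.
Qed.

(** For odd [j] the left side vanishes; for even [j] the closed form reduces the claim to
    [bin_sqr_le]. *)
Lemma kraw_sqr_le (R : realFieldType) h j : (j <= h.*2)%N ->
  'C(h.*2, j)%:R * kraw R h j ^+ 2 <= 'C(h.*2, h)%:R ^+ 2.
Proof.
move=> lej.
have [oj|ej] := boolP (odd j).
  rewrite -(odd_double_half j) oj add1n kraw_odd; last by lia.
  by rewrite expr2 mulr0 mulr0 exprn_ge0.
have ej2 : j = j./2.*2 by rewrite -[LHS]odd_double_half (negbTE ej).
move: (j./2) ej2 lej => i -> lei.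
have := @kraw_even R h i; set c := 'C(h.*2, i.*2)%:R => /(_ ltac:(lia)) E.
have c0 : 0 < c by rewrite ltr0n bin_gt0.
rewrite -(ler_pM2l c0).
have -> : c * (c * kraw R h i.*2 ^+ 2) = (c * kraw R h i.*2) ^+ 2 by ring.
rewrite E !exprMn -exprM mulnC exprM sqrrN expr1n expr1n mul1r mulrC.
by apply: ler_wpM2r; rewrite ?exprn_ge0 // -natrX ler_nat bin_sqr_le.
Qed.

(** * Fourier analysis on the cube *)

(** A Boolean vector [s] encodes the sign vector [(-1) ^+ s k], so this is the pointwise product of
    signs. *)
Definition cube_xor (I : finType) (s z : {ffun I -> bool}) : {ffun I -> bool} :=
  [ffun k => s k (+) z k].

Definition avg (R : realFieldType) (I : finType) (F : {ffun I -> bool} -> R) : R :=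
  2 ^- #|I| * \sum_s F s.

Definition chi (R : realFieldType) (I : finType) (U : {set I}) (s : {ffun I -> bool}) : R :=
  \prod_(k in U) (-1) ^+ s k.

Lemma cube_xorC (I : finType) (s z : {ffun I -> bool}) : cube_xor s z = cube_xor z s.
Proof. by apply/ffunP => k; rewrite !ffunE addbC. Qed.

Lemma cube_xorK (I : finType) (z : {ffun I -> bool}) : involutive (fun s => cube_xor s z).
Proof. by move=> s; apply/ffunP => k; rewrite !ffunE addbK. Qed.

Lemma avg_xor (R : realFieldType) (I : finType) (F : {ffun I -> bool} -> R) z :
  avg (fun s => F (cube_xor s z)) = avg F.
Proof.
rewrite /avg; congr (_ * _); rewrite [RHS](reindex_inj (inv_inj (cube_xorK z))).
by [].
Qed.

Lemma avg_ext (R : realFieldType) (I : finType) (F G : {ffun I -> bool} -> R) :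
  F =1 G -> avg F = avg G.
Proof. by move=> FG; rewrite /avg (eq_bigr _ (fun s _ => FG s)). Qed.

Lemma avg_le (R : realFieldType) (I : finType) (F G : {ffun I -> bool} -> R) :
  (forall s, F s <= G s) -> avg F <= avg G.
Proof.
by move=> FG; apply: ler_wpM2l; rewrite ?invr_ge0 ?exprn_ge0 //; apply: ler_sum.
Qed.

Lemma avg_ge0 (R : realFieldType) (I : finType) (F : {ffun I -> bool} -> R) :
  (forall s, 0 <= F s) -> 0 <= avg F.
Proof.
by move=> F0; rewrite mulr_ge0 ?invr_ge0 ?exprn_ge0 //; apply: sumr_ge0.
Qed.

Lemma avgZ (R : realFieldType) (I : finType) (c : R) (F : {ffun I -> bool} -> R) :
  avg (fun s => c * F s) = c * avg F.
Proof. by rewrite /avg -mulr_sumr mulrCA. Qed.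

Lemma avgD (R : realFieldType) (I : finType) (F G : {ffun I -> bool} -> R) :
  avg (fun s => F s + G s) = avg F + avg G.
Proof. by rewrite /avg big_split mulrDr. Qed.

Lemma avg_const (R : realFieldType) (I : finType) (c : R) :
  avg (fun _ : {ffun I -> bool} => c) = c.
Proof.
rewrite /avg sumr_const card_ffun card_bool -[c *+ _]mulr_natl mulrA natrX mulVf ?mul1r //.
Qed.

Lemma chi_xor (R : realFieldType) (I : finType) (U : {set I}) (s z : {ffun I -> bool}) :
  chi R U (cube_xor s z) = chi R U s * chi R U z.
Proof. by rewrite -big_split; apply: eq_bigr => k _; rewrite ffunE signr_addb. Qed.

Lemma normr_chi (R : realFieldType) (I : finType) (U : {set I}) (s : {ffun I -> bool}) :
  `|chi R U s| = 1.
Proof. by rewrite normr_prod big1 // => k _; rewrite normr_sign. Qed.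

Lemma sum_chi (R : realFieldType) (I : finType) (s : {ffun I -> bool}) :
  \sum_(U : {set I}) chi R U s = if s == [ffun=> false] then 2 ^+ #|I| else 0.
Proof.
have E : \sum_(U : {set I}) chi R U s = \prod_k ((-1) ^+ s k + 1).
  rewrite bigA_distr; apply: eq_bigr => U _; rewrite /chi big_mkcond /=.
  by apply: eq_bigr => k _; case: ifP.
rewrite {}E; case: eqP => [->|ne].
  by under eq_bigr do rewrite ffunE expr0; rewrite prodr_const.
have [k sk] : exists k, s k.
  apply/existsP; apply: contra_notT ne; rewrite negb_exists => /forallP h.
  by apply/ffunP => k; rewrite ffunE; apply/negbTE/h.
by rewrite (bigD1 k) //= sk expr1 addNr mul0r.
Qed.

(** The autocorrelation of [g] has the squared Fourier coefficients of [g] as its own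
    coefficients. *)
Lemma avg_mul_xor (R : realFieldType) (I : finType) (g : {ffun I -> bool} -> R) z :
  avg (fun s => g s * g (cube_xor s z)) =
  \sum_(U : {set I}) avg (fun s => g s * chi R U s) ^+ 2 * chi R U z.
Proof.
pose c : R := 2 ^- #|I|.
transitivity (\sum_(U : {set I}) \sum_s \sum_s'
    c ^+ 2 * (g s * g s') * chi R U (cube_xor s (cube_xor z s'))); last first.
  apply: eq_bigr => U _; rewrite /avg -/c exprMn expr2 [(\sum_s _) ^+ 2]expr2.
  rewrite big_distrlr /= mulr_sumr mulr_suml; apply: eq_bigr => s _.
  rewrite mulr_sumr mulr_suml; apply: eq_bigr => s' _.
  by rewrite !chi_xor; ring.
rewrite exchange_big /=.
rewrite /avg mulr_sumr; apply: eq_bigr => s _.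
(* Summing over all characters leaves only the term [s' = cube_xor s z]. *)
rewrite exchange_big /= (bigD1 (cube_xor s z)) //=.
rewrite -mulr_sumr sum_chi big1 ?addr0 => [|s' ne].
  rewrite (_ : cube_xor s (cube_xor z _) = [ffun=> false]) ?eqxx; last first.
    by apply/ffunP => k; rewrite !ffunE; case: (s k); case: (z k).
  have cK : c * 2 ^+ #|I| = 1 by rewrite mulVf // expf_neq0 // pnatr_eq0.
  rewrite -/c; transitivity (c * (g s * g (cube_xor s z)) * (c * 2 ^+ #|I|)); last by ring.
  by rewrite cK mulr1.
rewrite -mulr_sumr sum_chi ifF ?mulr0 //; apply/negP => /eqP /ffunP e.
move/eqP: ne; apply; apply/ffunP => k; move: (e k); rewrite !ffunE.
by case: (s k); case: (z k); case: (s' k).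
Qed.

(** * Generating functions for balanced sign vectors *)

Definition ones (I : finType) (T : {set I}) (s : {ffun I -> bool}) : nat :=
  (\sum_(k in T) s k)%N.

Definition balanced (I : finType) (T : {set I}) (s : {ffun I -> bool}) : bool :=
  ((ones T s).*2 <= #|T|.+1)%N && (#|T| <= (ones T s).*2.+1)%N.

Lemma balancedP (R : realFieldType) (I : finType) (T : {set I}) (s : {ffun I -> bool}) :
  (`|\sum_(k in T) (-1) ^+ s k : R| <= 1) = balanced T s.
Proof.
have -> : \sum_(k in T) (-1) ^+ s k = #|T|%:R - (ones T s).*2%:R :> R.
  rewrite /ones -mul2n natrM natr_sum mulr_sumr -sum1_card natr_sum -sumrB.
  by apply: eq_bigr => k _; case: (s k); rewrite /= ?expr1 ?expr0; ring.
rewrite /balanced; move: (ones T s).*2 #|T| => r t.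
rewrite ler_norml lerBlDr [1 + _]addrC natr1 ler_nat.
by rewrite lerBrDr addrC lerBlDr natr1 ler_nat.
Qed.

(** The sum factors over coordinates: [1 - 'X] on [U] inside [T], [1 + 'X] on the rest of [T], 2
    outside both sets, and 0 on [U] outside [T]. *)
Lemma sum_chi_Xones (R : realFieldType) (I : finType) (T U : {set I}) :
  \sum_s chi R U s *: 'X^(ones T s) =
  if U \subset T then
    (2 ^+ (#|I| - #|T|)) *: ((1 + 'X) ^+ (#|T| - #|U|) * (1 - 'X) ^+ #|U|)
  else 0.
Proof.
pose F k (b : bool) : {poly R} :=
  (if k \in U then (-1) ^+ b else 1) * (if k \in T then 'X^b else 1).
have -> : \sum_s chi R U s *: 'X^(ones T s) = \sum_(s : {ffun I -> bool}) \prod_k F k (s k).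
  apply: eq_bigr => s _; rewrite big_split /= -mul_polyC; congr (_ * _).
    rewrite /chi big_mkcond rmorph_prod; apply: eq_bigr => k _.
    by case: ifP => // _; rewrite rmorphXn rmorphN1.
  by rewrite -big_mkcond /= prodrXr.
rewrite -bigA_distr_bigA /=.
have Fk k : \sum_b F k b = if k \in U then (if k \in T then 1 - 'X else 0)
     else (if k \in T then 1 + 'X else 2).
  rewrite big_bool /F /=; case: ifP => _; case: ifP => _;
    by rewrite ?expr0 ?expr1 ?mulr1 ?mul1r ?mulN1r ?addNr // addrC.
rewrite (eq_bigr _ (fun k _ => Fk k)).
case: ifP => [UT|/negbT]; last first.
  by case/fintype.subsetPn => k kU kT; rewrite (bigD1 k) //= kU (negbTE kT) mul0r.
rewrite (bigID (mem U)) /= (bigID (mem T) (fun k => k \notin U)) /=.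
rewrite (eq_bigr (fun=> 1 - 'X)) => [|k kU]; last by rewrite kU (fintype.subsetP UT).
rewrite [X in _ * (X * _)](eq_bigr (fun=> 1 + 'X)) => [|k /andP[/negbTE -> ->]] //.
rewrite [X in _ * (_ * X)](eq_bigr (fun=> 2)) => [|k /andP[/negbTE -> /negbTE ->]] //.
rewrite !prodr_const.
have -> : #|(fun k => (k \notin U) && (k \in T))| = (#|T| - #|U|)%N.
  rewrite -(finset.setIidPr UT) -cardsD; apply: eq_card => k.
  by rewrite [LHS]unfold_in !inE; case: (k \in T); rewrite ?andbF.
have -> : #|(fun k => (k \notin U) && (k \notin T))| = (#|I| - #|T|)%N.
  rewrite -(cardsC T) addKn; apply: eq_card => k; rewrite [LHS]unfold_in !inE.
  by case: (boolP (k \in T)) => [_|kT]; rewrite ?andbF // andbT (contra (fintype.subsetP UT k)).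
rewrite -mul_polyC rmorphXn rmorph_nat.
by move: (_ ^+ _) (_ ^+ _) (_ ^+ _) => x y z; ring.
Qed.

(* Both parities of #|T| are covered: for odd #|T| the factor [1 + 'X] adds up the two
   admissible values of [ones T s]. *)
Lemma coef_balanced (R : realFieldType) (I : finType) (T : {set I}) (s : {ffun I -> bool}) :
  ((1 + 'X) ^+ odd #|T| * 'X^(ones T s) : {poly R})`_(uphalf #|T|) = (balanced T s)%:R.
Proof.
rewrite coefMXn coef_addX_exp /balanced.
move: (ones T s) #|T| => r t.
have ot := odd_double_half t; have ut := uphalf_half t.
case: ltnP => h.
  by rewrite (_ : _ && _ = false) //; apply/negP => /andP[]; case: (odd t) ot ut; lia.
case E : (uphalf t - r)%N => [|[|d]].
- by rewrite bin0 (_ : _ && _ = true) //; apply/andP; case: (odd t) ot ut; split; lia.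
- rewrite bin1; congr ((nat_of_bool _)%:R).
  case: (odd t) ot ut => ot ut; first by apply/esym/andP; split; lia.
  by apply/esym/negP => /andP[]; lia.
- rewrite bin_small; last by case: (odd t).
  by rewrite (_ : _ && _ = false) //; apply/negP => /andP[]; case: (odd t) ot ut; lia.
Qed.

(** The extra factor [(1 + 'X) ^+ odd #|T|] of [coef_balanced] rounds [#|T|] up to the even number
    [(uphalf #|T|).*2], so both parities lead to a middle Krawtchouk number. *)
Lemma avg_balanced_chi (R : realFieldType) (I : finType) (T U : {set I}) :
  2 ^+ #|T| * avg (fun s => (balanced T s)%:R * chi R U s) =
  if U \subset T then kraw R (uphalf #|T|) #|U| else 0.
Proof.
have leT : (#|T| <= #|I|)%N by exact: max_card.
have -> : avg (fun s => (balanced T s)%:R * chi R U s) = 2 ^- #|I| *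
    ((1 + 'X) ^+ odd #|T| * \sum_s chi R U s *: 'X^(ones T s))`_(uphalf #|T|).
  rewrite /avg; congr (_ * _); rewrite mulr_sumr coef_sum; apply: eq_bigr => s _.
  by rewrite -scalerAr coefZ coef_balanced mulrC.
rewrite sum_chi_Xones; case: ifP => [UT|_]; last by rewrite mulr0 coef0 !mulr0.
rewrite -(scalerAr _ ((1 + 'X) ^+ _)) coefZ; have UTc := subset_leq_card UT.
have -> : (1 + 'X) ^+ odd #|T| * ((1 + 'X) ^+ (#|T| - #|U|) * (1 - 'X) ^+ #|U|) =
    (1 + 'X) ^+ ((uphalf #|T|).*2 - #|U|) * (1 - 'X) ^+ #|U| :> {poly R}.
  rewrite mulrA -exprD; congr (_ ^+ _ * _).
  by rewrite uphalf_half doubleD -{2 3}(odd_double_half #|T|); case: odd; lia.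
rewrite /kraw.
have -> : 2 ^+ (#|I| - #|T|) = 2 ^+ #|I| / 2 ^+ #|T| :> R.
  by rewrite -{2}(subnK leT) exprD mulfK // expf_neq0 // pnatr_eq0.
by field; rewrite !expf_neq0 // pnatr_eq0.
Qed.

(** * Correlations of the balanced indicator *)

(** The factor is the inverse of the probability that a uniform sign vector is balanced on [T]; for
    odd [#|T|] the two middle binomials add up to the central one of [#|T|.+1]. *)
Definition psi (R : realFieldType) (I : finType) (K : nat) (T : {set I})
    (s : {ffun I -> bool}) : R :=
  if (#|T| <= K)%N then
    2 ^+ #|T| / 'C((uphalf #|T|).*2, uphalf #|T|)%:R * (balanced T s)%:R
  else 0.

(* Square of the Fourier coefficient of [psi] at a set of size [j], when #|T| = t. *)
Definition krawR (R : realFieldType) (t j : nat) : R :=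
  (kraw R (uphalf t) j / 'C((uphalf t).*2, uphalf t)%:R) ^+ 2.

Definition kappa (R : realFieldType) (I : finType) (j : nat) (z : {ffun I -> bool}) : R :=
  (\sum_(U : {set I} | #|U| == j) chi R U z) / 'C(#|I|, j)%:R.

(** The support [T] is random, each index belonging to it independently with probability [q]; [z] is
    the product of the two sign vectors being compared. *)
Definition corr (R : realFieldType) (I : finType) (K : nat) (q : R)
    (z : {ffun I -> bool}) : R :=
  \sum_(T : {set I}) q ^+ #|T| * (1 - q) ^+ (#|I| - #|T|) *
     avg (fun s => psi R K T s * psi R K T (cube_xor s z)).

Lemma psi_ge0 (R : realFieldType) (I : finType) K (T : {set I}) s : 0 <= psi R K T s.
Proof. by rewrite /psi; case: ifP => // _; rewrite !mulr_ge0 ?invr_ge0 ?exprn_ge0 ?ler0n. Qed.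

Lemma central_bin_neq0 (R : realFieldType) h : 'C(h.*2, h)%:R != 0 :> R.
Proof. by rewrite pnatr_eq0 -lt0n bin_gt0; lia. Qed.

Lemma avg_psi_chi (R : realFieldType) (I : finType) K (T U : {set I}) :
  avg (fun s => psi R K T s * chi R U s) =
  if (#|T| <= K)%N && (U \subset T) then
    kraw R (uphalf #|T|) #|U| / 'C((uphalf #|T|).*2, uphalf #|T|)%:R else 0.
Proof.
rewrite /psi; case: (leqP #|T| K) => _ /=; last first.
  by rewrite (@avg_ext _ _ _ (fun=> 0)) ?avg_const // => s; rewrite mul0r.
rewrite (@avg_ext _ _ _ (fun s => 2 ^+ #|T| / 'C((uphalf #|T|).*2, uphalf #|T|)%:R *
  ((balanced T s)%:R * chi R U s))); last by move=> s; rewrite mulrA.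
rewrite avgZ mulrAC avg_balanced_chi.
by case: ifP; rewrite ?mul0r.
Qed.

Lemma avg_psi (R : realFieldType) (I : finType) K (T : {set I}) :
  avg (psi R K T) = (#|T| <= K)%N%:R.
Proof.
rewrite -(@avg_ext _ _ (fun s => psi R K T s * chi R finset.set0 s)); last first.
  by move=> s; rewrite /chi big_set0 mulr1.
rewrite avg_psi_chi finset.sub0set andbT cards0 kraw0 divff ?central_bin_neq0 //.
by case: ifP.
Qed.

Lemma avg_psi_xor (R : realFieldType) (I : finType) K (T : {set I}) z :
  avg (fun s => psi R K T s * psi R K T (cube_xor s z)) =
  if (#|T| <= K)%N then
    \sum_(U : {set I} | U \subset T) krawR R #|T| #|U| * chi R U z else 0.
Proof.
rewrite avg_mul_xor; case: ifP => TK.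
  rewrite [RHS]big_mkcond; apply: eq_bigr => U _; rewrite avg_psi_chi TK /=.
  by case: ifP => // _; rewrite expr2 !mul0r.
by rewrite big1 // => U _; rewrite avg_psi_chi TK expr2 !mul0r.
Qed.

(** Complementation maps these supersets onto the subsets of [~: U] of size [#|I| - t]. *)
Lemma card_supersets (I : finType) (U : {set I}) t : (t <= #|I|)%N ->
  #|[set T : {set I} | (#|T| == t) && (U \subset T)]%SET| = 'C(#|I| - #|U|, #|I| - t).
Proof.
move=> tI; have <- : #|~: U| = (#|I| - #|U|)%N by rewrite -(cardsC U) addKn.
rewrite -cards_draws -(card_imset _ (inv_inj (@finset.setCK I))).
apply: eq_card => A; rewrite inE; apply/imsetP/andP => [[T]|[AU /eqP cA]].
  rewrite inE => /andP[/eqP cT UT] ->; rewrite finset.setCS UT; split=> //.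
  by rewrite -cT -(cardsC T) addKn.
exists (~: A); rewrite ?finset.setCK // inE -finset.setCS finset.setCK AU andbT.
by rewrite -(eqn_add2l #|A|) cardsC cA subnK.
Qed.

Lemma bin_trinomial n t j : (t <= n)%N -> (j <= t)%N ->
  ('C(n - j, n - t) * 'C(n, j) = 'C(n, t) * 'C(t, j))%N.
Proof.
move=> tn jt; have jn := leq_trans jt tn.
have le1 : (n - t <= n - j)%N by lia.
have f1 := bin_fact le1; have f2 := bin_fact jn.
have f3 := bin_fact tn; have f4 := bin_fact jt.
have e : (n - j - (n - t) = t - j)%N by lia.
rewrite e in f1.
have p0 : (0 < j`! * (n - t)`! * (t - j)`!)%N by rewrite !muln_gt0 !fact_gt0.
apply/eqP; rewrite -(eqn_pmul2r p0); apply/eqP.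
transitivity n`!.
  by rewrite -f2 -f1; ring.
by rewrite -f3 -f4; ring.
Qed.

(** Double counting: each [U] of size [j] lies in the same number of sets [T] of size [t], and
    [bin_trinomial] rewrites this number. *)
Lemma sum_subsets_chi (R : realFieldType) (I : finType) t j (z : {ffun I -> bool}) :
  (t <= #|I|)%N ->
  \sum_(T : {set I} | #|T| == t) \sum_(U : {set I} | (U \subset T) && (#|U| == j)) chi R U z
  = 'C(#|I|, t)%:R * 'C(t, j)%:R * kappa R j z.
Proof.
move=> tI.
rewrite (exchange_big_dep (fun U : {set I} => #|U| == j)) /=; last first.
  by move=> T U _ /andP[].
have [jt|tj] := leqP j t; last first.
  rewrite (@bin_small t j) // mulr0 mul0r big1 // => U /eqP cU; rewrite big_pred0 // => T.
  apply/negP => /andP[/eqP cT /andP[/subset_leq_card]]; rewrite cU cT; lia.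
have jI := leq_trans jt tI.
have nz : 'C(#|I|, j)%:R != 0 :> R by rewrite pnatr_eq0 -lt0n bin_gt0.
rewrite -natrM -bin_trinomial // natrM /kappa -mulrA [_ * (_ / _)]mulrC divfK //.
rewrite mulr_sumr; apply: eq_bigr => U /eqP cU.
rewrite sumr_const mulr_natl; congr (_ *+ _).
rewrite -cU -(card_supersets U tI) //; apply: eq_card => T; rewrite !inE.
by rewrite unfold_in cU eqxx andbT.
Qed.

Lemma kappa0 (R : realFieldType) (I : finType) (z : {ffun I -> bool}) : kappa R 0 z = 1.
Proof.
rewrite /kappa bin0 divr1 (bigD1 finset.set0) ?cards0 //= big1 ?addr0.
  by rewrite /chi big_set0.
by move=> U /andP[]; rewrite cards_eq0 => /eqP ->; rewrite eqxx.
Qed.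

Lemma normr_kappa_le1 (R : realFieldType) (I : finType) j (z : {ffun I -> bool}) :
  `|kappa R j z| <= 1.
Proof.
rewrite /kappa normrM normfV normr_nat.
have -> : 'C(#|I|, j)%:R = \sum_(U : {set I} | #|U| == j) `|chi R U z|.
  rewrite (eq_bigr (fun=> 1)) => [|U _]; last by rewrite normr_chi.
  rewrite sumr_const -card_draws; congr (_ *+ _).
  by apply: eq_card => U; rewrite inE.
(* The first case covers [j > #|I|]: the binomial is 0 and so is its inverse. *)
have [h|h] := leP (\sum_(U : {set I} | #|U| == j) `|chi R U z|) 0.
  have -> : \sum_(U : {set I} | #|U| == j) `|chi R U z| = 0.
    by apply/eqP; rewrite eq_le h sumr_ge0.
  by rewrite invr0 mulr0 ler01.
by rewrite ler_pdivrMr // mul1r ler_norm_sum.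
Qed.

Lemma krawR0 (R : realFieldType) t : krawR R t 0 = 1.
Proof. by rewrite /krawR kraw0 divff ?central_bin_neq0 // expr1n. Qed.

Lemma krawR_bin1 (R : realFieldType) t : krawR R t 1 * 'C(t, 1)%:R = 0.
Proof.
case: t => [|t]; first by rewrite bin_small ?mulr0.
by rewrite /krawR (@kraw_odd _ _ 0) ?mul0r ?expr2 ?mul0r //=; lia.
Qed.

(** Since [t <= (uphalf t).*2], the binomial is at most the one in [kraw_sqr_le]. *)
Lemma krawR_bin_le1 (R : realFieldType) t j : krawR R t j * 'C(t, j)%:R <= 1.
Proof.
have [jt|tj] := leqP j t; last by rewrite bin_small // mulr0 ler01.
have th : (t <= (uphalf t).*2)%N by rewrite uphalf_half -{1}(odd_double_half t); case: odd; lia.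
rewrite /krawR expr_div_n mulrAC ler_pdivrMr; last first.
  by rewrite exprn_gt0 // ltr0n bin_gt0; lia.
rewrite mul1r; apply: le_trans (kraw_sqr_le R (leq_trans jt th)).
rewrite mulrC; apply: ler_wpM2r; first exact: sqr_ge0.
by rewrite ler_nat leq_bin2l.
Qed.

Lemma sum_sets_card (R : realFieldType) (I : finType) (P : pred {set I}) (F : {set I} -> R) :
  \sum_(T : {set I} | P T) F T = \sum_(t < #|I|.+1) \sum_(T : {set I} | P T && (#|T| == t)) F T.
Proof.
pose c (T : {set I}) : 'I_#|I|.+1 := inord #|T|.
rewrite (partition_big c xpredT) //=; apply: eq_bigr => t _; apply: eq_bigl => T.
by congr (_ && _); rewrite -val_eqE /= inordK // ltnS max_card.
Qed.

Lemma sum_bin_weights (R : realFieldType) (I : finType) (x y : R) :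
  \sum_(T : {set I}) x ^+ #|T| * y ^+ (#|I| - #|T|) = (x + y) ^+ #|I|.
Proof.
rewrite -prodr_const bigA_distr; apply: eq_bigr => T _.
rewrite (bigID (mem T)) /= (eq_bigr (fun=> x)) => [|k ->] //.
rewrite [X in _ = _ * X](eq_bigr (fun=> y)) => [|k /negbTE ->] //.
rewrite !prodr_const; congr (_ * _ ^+ _).
by rewrite -(cardsC T) addKn; apply: eq_card => k; rewrite !inE.
Qed.

(** Averaging over the supports of one size [t <= K] leaves a combination of the [kappa R j z] with
    coefficients in [[0, 1]], equal to 1 at [j = 0], to 0 at [j = 1] and to 0 for [j > t]. Sizes
    above [K] contribute nothing. *)
Lemma corr_le (R : realFieldType) (I : finType) K (q : R) (z : {ffun I -> bool}) :
  0 <= q -> q <= 1 -> (K <= #|I|)%N ->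
  corr K q z <= 1 + \sum_(2 <= j < K.+1) `|kappa R j z|.
Proof.
move=> q0 q1 KI; set B := (1 + _).
have B0 : 0 <= B by rewrite addr_ge0 // sumr_ge0.
pose w t : R := q ^+ t * (1 - q) ^+ (#|I| - t).
have w0 t : 0 <= w t by rewrite mulr_ge0 // exprn_ge0 // subr_ge0.
(* The binomial weights sum to 1, so both sides can be compared size by size. *)
have -> : B = \sum_(t < #|I|.+1) w t * 'C(#|I|, t)%:R * B.
  have : \sum_(T : {set I}) w #|T| = 1.
    by rewrite sum_bin_weights addrCA subrr addr0 expr1n.
  rewrite sum_sets_card -mulr_suml => E.
  rewrite -[LHS]mul1r -[X in X * _ = _]E; congr (_ * _); apply: eq_bigr => t _.
  rewrite (eq_bigr (fun=> w t)) => [|T /eqP ->] //.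
  rewrite sumr_const -card_draws mulr_natr; congr (_ *+ _).
  by apply: eq_card => T; rewrite !inE.
rewrite /corr sum_sets_card; apply: ler_sum => t _.
rewrite (eq_bigr (fun T : {set I} => w t * avg (fun s => psi R K T s * psi R K T (cube_xor s z))));
  last by move=> T /eqP ->.
rewrite -mulr_sumr -mulrA; apply: ler_wpM2l => //.
have tI : (t <= #|I|)%N by rewrite -ltnS.
have [tK|Kt] := leqP t K; last first.
  rewrite big1 => [|T /eqP cT]; first by rewrite mulr_ge0.
  by rewrite avg_psi_xor cT leqNgt Kt.
have -> : \sum_(T : {set I} | true && (#|T| == t))
      avg (fun s => psi R K T s * psi R K T (cube_xor s z)) =
    'C(#|I|, t)%:R * \sum_(j < #|I|.+1) krawR R t j * 'C(t, j)%:R * kappa R j z.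
  transitivity (\sum_(T : {set I} | #|T| == t) \sum_(j < #|I|.+1)
     krawR R t j * \sum_(U : {set I} | (U \subset T) && (#|U| == j)) chi R U z).
    apply: eq_bigr => T /eqP cT; rewrite avg_psi_xor cT tK sum_sets_card.
    apply: eq_bigr => j _; rewrite mulr_sumr; apply: eq_bigr => U /andP[_ /eqP ->].
    by [].
  rewrite exchange_big mulr_sumr; apply: eq_bigr => j _ /=.
  by rewrite -mulr_sumr sum_subsets_chi //; ring.
apply: ler_wpM2l; first exact: ler0n.
rewrite -(big_mkord xpredT (fun j => krawR R t j * 'C(t, j)%:R * kappa R j z)).
rewrite (@big_cat_nat _ _ _ K.+1) //= [X in _ + X]big_nat_cond [X in _ + X]big1 ?addr0; last first.
  by move=> j /andP[/andP[Kj _] _]; rewrite (@bin_small t j) ?mulr0 ?mul0r //; lia.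
rewrite big_ltn // krawR0 bin0 !mul1r kappa0 lerD2l.
have le2 j : krawR R t j * 'C(t, j)%:R * kappa R j z <= `|kappa R j z|.
  rewrite (le_trans (ler_norm _)) // normrM ler_piMl // ger0_norm ?krawR_bin_le1 //.
  by rewrite mulr_ge0 ?sqr_ge0.
case: K {KI B B0 tK} => [|K]; first by rewrite !big_geq.
rewrite big_ltn // krawR_bin1 mul0r add0r.
by apply: ler_sum.
Qed.

Lemma corr_ge0 (R : realFieldType) (I : finType) K (q : R) (z : {ffun I -> bool}) :
  0 <= q -> q <= 1 -> 0 <= corr K q z.
Proof.
move=> q0 q1; apply: sumr_ge0 => T _; apply: mulr_ge0.
  by rewrite mulr_ge0 ?exprn_ge0 ?subr_ge0.
by apply: avg_ge0 => s; rewrite mulr_ge0 ?psi_ge0.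
Qed.

(** * Decay of the normalized elementary symmetric polynomials *)

Definition signsum (R : realFieldType) (I : finType) (z : {ffun I -> bool}) : R :=
  \sum_k (-1) ^+ z k.

Definition esym (R : realFieldType) (I : finType) (j : nat) (z : {ffun I -> bool}) : R :=
  \sum_(U : {set I} | #|U| == j) chi R U z.

Lemma esym_genfun (R : realFieldType) (I : finType) j (z : {ffun I -> bool}) :
  esym R j z = (\prod_k (1 + (-1) ^+ z k *: 'X) : {poly R})`_j.
Proof.
under eq_bigr do rewrite addrC.
rewrite bigA_distr coef_sum /esym big_mkcond; apply: eq_bigr => U _ /=.
have -> : \prod_i (if i \in U then (-1) ^+ z i *: 'X else 1) = chi R U z *: 'X^#|U| :> {poly R}.
  rewrite -big_mkcond /= -prodr_const -mul_polyC /chi rmorph_prod -big_split /=.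
  by apply: eq_bigr => k _; rewrite mul_polyC.
by rewrite coefZ coefXn eq_sym; case: eqP => _; rewrite ?mulr1 ?mulr0.
Qed.

Lemma esym0 (R : realFieldType) (I : finType) (z : {ffun I -> bool}) : esym R 0 z = 1.
Proof. by have := kappa0 R z; rewrite /kappa bin0 divr1. Qed.

(** Logarithmic derivative: for a sign [e], [e / (1 + e * 'X)] equals [(e - 'X) / (1 - 'X ^+ 2)]
    because [e ^+ 2 = 1]. Induction on the list of indices avoids the fractions. *)
Lemma genfun_ode (R : realFieldType) (I : finType) (z : {ffun I -> bool}) :
  let F := \prod_k (1 + (-1) ^+ z k *: 'X) : {poly R} in
  (1 - 'X ^+ 2) * F^`() = ((signsum R z)%:P - #|I|%:R * 'X) * F.
Proof.
rewrite /= /signsum -sum1_card natr_sum.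
elim: (index_enum I) => [|k r IH].
  by rewrite !big_nil derivC polyC0 mulr0 mul0r subr0 mul0r.
rewrite !big_cons /= derivM mulrDr [X in _ + X]mulrCA {}IH.
rewrite derivD derivZ derivX derivC add0r alg_polyC -mul_polyC polyCD.
have : ((-1) ^+ z k)%:P * ((-1) ^+ z k)%:P = 1 :> {poly R}.
  by rewrite -polyCM -expr2 sqrr_sign.
set e := ((-1) ^+ z k)%:P; set P := \prod_(i <- r) _.
set s := (\sum_(i <- r) _)%:P; set t := \sum_(i <- r) 1%:R.
move: e P s t 'X => e P s t x e2.
transitivity (e * P - (x ^+ 2 * e) * P + (1 + e * x) * (s - t * x) * P); first by ring.
transitivity ((e * P - x * P + e * x * e * P - (x * e * x) * P) + (1 + e * x) * (s - t * x) * P);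
  last by ring.
congr (_ + _); rewrite [e * x]mulrC -[x * e * e]mulrA e2 mulr1.
by ring.
Qed.

Lemma esym1 (R : realFieldType) (I : finType) (z : {ffun I -> bool}) :
  esym R 1 z = signsum R z.
Proof.
have := congr1 (fun p : {poly R} => p`_0) (genfun_ode R z) => /=.
rewrite mulrBl mul1r coefB coefXnM /= subr0 coef_deriv -esym_genfun.
rewrite mulrBl coefB coefCM -esym_genfun esym0 mulr1 -mulrA mulr_natl coefMn coefXM /=.
by rewrite mul0rn subr0.
Qed.

(** This compares the coefficients of ['X^j.+1] in [genfun_ode]. *)
Lemma esym_rec (R : realFieldType) (I : finType) j (z : {ffun I -> bool}) : (j <= #|I|)%N ->
  j.+2%:R * esym R j.+2 z = signsum R z * esym R j.+1 z - (#|I| - j)%:R * esym R j z.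
Proof.
move=> jI; have := congr1 (fun p : {poly R} => p`_j.+1) (genfun_ode R z) => /= E.
rewrite mulrBl mul1r coefB coefXnM coef_deriv -esym_genfun in E.
rewrite mulrBl coefB coefCM -esym_genfun -mulrA mulr_natl coefMn coefXM /= in E.
rewrite -esym_genfun in E; rewrite mulr_natl natrB //.
case: j jI E => [|j] jI /= E.
  by move: E; rewrite !subr0 => ->; rewrite mulr_natl.
rewrite subSS subSS subn0 coef_deriv -esym_genfun in E.
by rewrite -[LHS](subrK (esym R j.+1 z *+ j.+1)) E -!(mulr_natl (esym _ _ _)); ring.
Qed.

Lemma kappa1 (R : realFieldType) (I : finType) (z : {ffun I -> bool}) :
  kappa R 1 z = signsum R z / #|I|%:R.
Proof. by rewrite /kappa bin1 -esym1. Qed.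

Lemma kappa_rec (R : realFieldType) (I : finType) j (z : {ffun I -> bool}) :
  (j.+2 <= #|I|)%N ->
  (#|I| - j.+1)%:R * kappa R j.+2 z = signsum R z * kappa R j.+1 z - j.+1%:R * kappa R j z.
Proof.
move=> jI; have := esym_rec R z (ltnW (ltnW jI)).
have ek i : (i <= #|I|)%N -> esym R i z = 'C(#|I|, i)%:R * kappa R i z.
  by move=> iI; rewrite /kappa mulrC divfK // pnatr_eq0 -lt0n bin_gt0.
rewrite !ek ?(ltnW jI) ?(ltnW (ltnW jI)) //.
have r1 := congr1 (fun k : nat => k%:R : R) (mul_bin_left #|I| j).
have r2 := congr1 (fun k : nat => k%:R : R) (mul_bin_left #|I| j.+1).
rewrite /= !natrM in r1 r2.
have nz : 'C(#|I|, j.+1)%:R != 0 :> R by rewrite pnatr_eq0 -lt0n bin_gt0 ltnW.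
rewrite mulrA r2 [X in _ - X]mulrA -r1 => E.
by apply: (mulfI nz); rewrite mulrBr mulrA [_ * (_ - _)%:R]mulrC E; ring.
Qed.

(** * Bounds for solutions of the three-term recurrence *)

Section Decay.
Variables (R : realFieldType) (N : nat) (S : R) (v : nat -> R).
Hypothesis v_rec : forall j, (j.+2 <= N)%N ->
  (N - j.+1)%:R * v j.+2 = S * v j.+1 - j.+1%:R * v j.
Hypothesis smallS : 20 * `|S| <= N%:R.

Lemma rec_norm j (a b : R) : (j.+2 <= N)%N -> `|v j.+1| <= a -> `|v j| <= b ->
  (N%:R - j.+1%:R) * `|v j.+2| <= N%:R / 20 * a + j.+1%:R * b.
Proof.
move=> jN va vb; rewrite -natrB; last exact: ltnW.
rewrite -[X in X * _]ger0_norm ?ler0n // -normrM v_rec //.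
apply: le_trans (ler_normB _ _) _; rewrite !normrM normr_nat.
apply: lerD; last by rewrite ler_wpM2l.
apply: ler_pM => //; rewrite ler_pdivlMr ?ltr0n // mulrC //.
Qed.

(** With [y = j.+1 <= N / 8] one has [N / 10 + 4 * y <= N - y], hence a factor [1 / 2] per step. *)
Lemma decay_step j (B : R) : (8 * j.+1 <= N)%N -> `|v j| <= 4 * B -> `|v j.+1| <= 2 * B ->
  `|v j.+2| <= B.
Proof.
move=> jN vj vj1; have jN2 : (j.+2 <= N)%N by lia.
have := rec_norm jN2 vj1 vj.
have B0 : 0 <= B by have := normr_ge0 (v j); lra.
have : 8 * j.+1%:R <= N%:R :> R by rewrite -natrM ler_nat.
have : 1 <= j.+1%:R :> R by rewrite ler1n.
move: (j.+1%:R) (N%:R) => y x y1 xy h.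
have xy0 : 0 < x - y by lra.
rewrite -(ler_pM2l xy0); apply: le_trans h _.
have p1 : 0 <= B * (x - 8 * y) by rewrite mulr_ge0 // subr_ge0.
have p2 : 0 <= B * x by rewrite mulr_ge0 //; lra.
by lra.
Qed.

(** Beyond [N / 8] growth by [9 / 8] per step is allowed: [9 / 160 * N + y <= 81 / 64 * (N - y)]
    holds for [y <= 17 * N / 32], slightly past the middle. *)
Lemma growth_step j (B : R) : (32 * j.+1 <= 17 * N)%N -> `|v j| <= B ->
  `|v j.+1| <= 9 / 8 * B -> `|v j.+2| <= 9 / 8 * (9 / 8 * B).
Proof.
move=> jN vj vj1; have jN2 : (j.+2 <= N)%N by lia.
have := rec_norm jN2 vj1 vj.
have B0 : 0 <= B by have := normr_ge0 (v j); lra.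
have : 32 * j.+1%:R <= 17 * N%:R :> R by rewrite -!natrM ler_nat.
have : 1 <= j.+1%:R :> R by rewrite ler1n.
move: (j.+1%:R) (N%:R) => y x y1 xy h.
have xy0 : 0 < x - y by lra.
rewrite -(ler_pM2l xy0); apply: le_trans h _.
have p1 : 0 <= B * (17 * x - 32 * y) by rewrite mulr_ge0 // subr_ge0.
have p2 : 0 <= B * x by rewrite mulr_ge0 //; lra.
by lra.
Qed.

Hypothesis v0 : v 0%N = 1.
Hypothesis v1 : v 1%N = S / N%:R.
Hypothesis N32 : (32 <= N)%N.

Let e := S ^+ 2 / N%:R ^+ 2 + N%:R^-1.

(** The recurrence gives [(N - 1) * v 2 = S ^+ 2 / N - 1], of modulus at most [N * e]. For [v 3] the
    inputs are [1 <= N * e] and [|v 1| <= 1 / 20]. *)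
Lemma decay_init : `|v 2| <= 2 * e /\ `|v 3| <= e.
Proof.
have N32R : 32 <= N%:R :> R by rewrite (ler_nat _ 32).
have Nn0 : N%:R != 0 :> R by rewrite gt_eqF //; lra.
have eN : N%:R * e = S * (S / N%:R) + 1 by rewrite /e; field.
have eN1 : 1 <= N%:R * e.
  by rewrite eN lerDr mulrA -expr2 divr_ge0 ?sqr_ge0.
have e0 : 0 <= e by rewrite /e addr_ge0 ?divr_ge0 ?sqr_ge0 ?invr_ge0 //.
have h2 : `|v 2| <= 2 * e.
  have : (N - 1)%:R * `|v 2| <= N%:R * e.
    rewrite -[X in X * _]normr_nat -normrM v_rec; last by lia.
    rewrite v1 v0 mulr1 (le_trans (ler_normB _ _)) // normr1 eN lerD2r.
    by rewrite ger0_norm // mulrA -expr2 divr_ge0 ?sqr_ge0.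
  rewrite natrB; last by lia.
  move: (N%:R) e N32R e0 {Nn0 eN eN1} => x e' x32 e0 h.
  have x1 : 0 < x - 1 by lra.
  rewrite -(ler_pM2l x1); apply: le_trans h _.
  have p1 : 0 <= e' * (x - 2) by rewrite mulr_ge0 //; lra.
  by lra.
split=> //.
have h1 : `|v 1| <= 1 / 20.
  rewrite v1 normrM normfV normr_nat ler_pdivrMr; last by lra.
  by move: smallS; lra.
have := @rec_norm 1 (2 * e) (1 / 20) _ h2 h1.
rewrite (_ : 3 <= N)%N; last by lia.
move=> /(_ isT); move: (N%:R) e N32R e0 {Nn0 eN h2} eN1 => x e' x32 e0 xe h.
have x1 : 0 < x - 2 by lra.
rewrite -(ler_pM2l x1); apply: le_trans h _.
have p1 : 0 <= e' * (x - 32) by rewrite mulr_ge0 //; lra.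
by lra.
Qed.

Lemma decay_low j : (2 <= j)%N -> (8 * j <= N)%N ->
  `|v j| <= 8 * e / 2 ^+ j /\ `|v j.+1| <= 8 * e / 2 ^+ j.+1.
Proof.
elim: j => // j IH; rewrite leq_eqVlt => /orP[/eqP <- _|j2 jN].
  have [h2 h3] := decay_init; split.
    by rewrite expr2; lra.
  by rewrite exprS expr2; lra.
have [|h h'] := IH j2; first by lia.
split=> //; apply: decay_step => //.
  apply: le_trans h _; rewrite !exprS !invfM; lra.
by apply: le_trans h' _; rewrite !exprS !invfM; lra.
Qed.

Let M := (N %/ 8)%N.

Lemma decay_high i : (32 * (M + i) <= 17 * N)%N ->
  `|v (M + i)%N| <= 8 * e / 2 ^+ M * (9 / 8) ^+ i /\
  `|v (M + i).+1| <= 8 * e / 2 ^+ M * (9 / 8) ^+ i.+1.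
Proof.
have e0 : 0 <= e by rewrite /e addr_ge0 ?divr_ge0 ?sqr_ge0 ?invr_ge0 //.
have M8 : (8 * M <= N)%N by rewrite /M mulnC leq_divM.
have M2 : (2 <= M)%N by rewrite /M; lia.
elim: i => [_|i IH iN].
  have [h h'] := decay_low M2 M8.
  rewrite addn0 expr0 expr1 mulr1; split => //; apply: le_trans h' _.
  have : 0 <= e / 2 ^+ M by rewrite divr_ge0 ?exprn_ge0.
  by rewrite exprS invfM; lra.
have [|h h'] := IH; first by lia.
rewrite addnS; split=> //.
rewrite !exprS ![_ * (9 / 8 * _)]mulrCA; apply: growth_step => //; first by lia.
by rewrite mulrCA -exprS.
Qed.

Lemma decay_sum K : (32 * K <= 17 * N)%N -> (M <= K)%N ->
  \sum_(2 <= j < K.+1) `|v j| <= 68 * e.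
Proof.
move=> KN MK.
have e0 : 0 <= e by rewrite /e addr_ge0 ?divr_ge0 ?sqr_ge0 ?invr_ge0 //.
have M8 : (8 * M <= N)%N by rewrite /M mulnC leq_divM.
have M2 : (2 <= M)%N by rewrite /M; lia.
(* The right side is the exact sum of the geometric bounds [8 * e / 2 ^+ j]. *)
have low n : (2 <= n)%N -> (n <= M.+1)%N ->
    \sum_(2 <= j < n) `|v j| <= 4 * e - 16 * e / 2 ^+ n.
  elim: n => // n IH; rewrite leq_eqVlt => /orP[/eqP <- _|n2 nM].
    by rewrite big_geq // expr2; lra.
  rewrite big_nat_recr //=; have [|h _] := @decay_low n n2; first by lia.
  have := IH n2 (ltnW nM); rewrite exprS invfM; lra.
(* A geometric sum of ratio [9 / 8] is at most 8 times its next term, which gives [64 = 8 * 8]. *)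
have high i : (M + i <= K)%N ->
    \sum_(2 <= j < (M + i).+1) `|v j| <= 4 * e + 64 * (e / 2 ^+ M) * (9 / 8) ^+ i.+1.
  elim: i => [_|i IH iK].
    rewrite addn0; apply: le_trans (low _ _ _) _ => //; first by lia.
    have : 0 <= e / 2 ^+ M by rewrite divr_ge0 ?exprn_ge0.
    by rewrite expr1 exprS invfM; lra.
  rewrite big_nat_recr /=; last by lia.
  have [|h _] := @decay_high i.+1; first by lia.
  have {}IH := IH ltac:(lia).
  rewrite addnS in h *; move: IH h; rewrite !exprS -(mulrA 8 e).
  move: (e / 2 ^+ M) ((9 / 8) ^+ i) => u g; lra.
have [i Ki] : exists i, K = (M + i)%N by exists (K - M)%N; lia.
rewrite Ki; apply: le_trans (high i _) _; first by lia.
(* Here [K - M] is at most about [13 * M / 4], and [M >= 4] absorbs the rounding. Since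
   [(9 / 8) ^+ 5 <= 2], the growth phase cannot undo the decay [2 ^+ M]. *)
have iM : (i.+1 <= 5 * M)%N by rewrite /M in Ki *; lia.
have : (9 / 8) ^+ i.+1 <= 2 ^+ M :> R.
  apply: (@le_trans _ _ ((9 / 8) ^+ (5 * M))).
    by apply: ler_weXn2l => //; lra.
  rewrite exprM; apply: lerXn2r; rewrite ?nnegrE ?exprn_ge0 ?divr_ge0 //.
  by rewrite !exprS expr0; lra.
have : 0 < 2 ^+ M :> R by rewrite exprn_gt0.
move: (2 ^+ M) ((9 / 8) ^+ i.+1) => u g u0 gu.
suff : e / u * g <= e by lra.
by rewrite -mulrA ler_piMr // mulrC ler_pdivrMr // mul1r.
Qed.

End Decay.

(** * Exponential moments *)

(** From [1 - x <= expR (- x)] one gets [expR x <= (1 - x)^-1], and [(1 - x) * (1 + x + 2 * x ^+ 2)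
    = 1 + x ^+ 2 * (1 - 2 * x)]. *)
Lemma expR_le_quadratic (R : realType) (x : R) : x <= 1 / 2 -> expR x <= 1 + x + 2 * x ^+ 2.
Proof.
move=> x2; have p : 0 < 1 - x by lra.
have := @expR_ge1Dx R (- x); rewrite expRN => h.
have {}h : expR x <= (1 - x)^-1.
  by rewrite -[X in X <= _]invrK lef_pV2 // posrE invr_gt0 expR_gt0.
apply: le_trans h _; rewrite -(ler_pM2l p) mulfV ?gt_eqF //.
have : 0 <= x ^+ 2 * (1 - 2 * x) by rewrite mulr_ge0 ?sqr_ge0 //; lra.
by rewrite expr2; lra.
Qed.

Lemma cosh_le (R : realType) (x : R) : `|x| <= 1 / 2 ->
  expR x + expR (- x) <= 2 * expR (2 * x ^+ 2).
Proof.
rewrite ler_norml => /andP[lx ux].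
have h1 := expR_le_quadratic ux.
have h2 : expR (- x) <= 1 + - x + 2 * (- x) ^+ 2 by apply: expR_le_quadratic; lra.
have := expR_ge1Dx (2 * x ^+ 2); rewrite sqrrN in h2; lra.
Qed.

(* Flipping one coordinate at a time averages [expR (a * (1 +- S) ^+ 2)] into
   [expR (a + a * S ^+ 2)] times a hyperbolic cosine. *)
Lemma avg_expR_sqr_seq (R : realType) (I : finType) (r : seq I) (a : R) :
  uniq r -> 0 <= a -> 16 * a * (size r)%:R <= 1 ->
  avg (fun z : {ffun I -> bool} => expR (a * (\sum_(k <- r) (-1) ^+ z k) ^+ 2))
  <= expR (2 * a * (size r)%:R).
Proof.
elim: r a => [|k r IH] a /=.
  move=> _ a0 _; rewrite mulr0 expR0 (@avg_ext _ _ _ (fun=> 1)) ?avg_const // => z.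
  by rewrite big_nil expr0n mulr0 expR0.
move=> /andP[kr ur] a0; rewrite -[(size r).+1%:R]natr1 => ha.
pose S (z : {ffun I -> bool}) : R := \sum_(k <- r) (-1) ^+ z k.
pose d : {ffun I -> bool} := [ffun i => i == k].
have Sd z : S (cube_xor z d) = S z.
  apply: eq_big_seq => i ir; rewrite !ffunE (_ : (i == k) = false) ?addbF //.
  by apply/negP => /eqP e; rewrite -e ir in kr.
have Sle z : `|S z| <= (size r)%:R.
  rewrite -sum1_size natr_sum (le_trans (ler_norm_sum _ _ _)) //.
  by apply: ler_sum => i _; rewrite normr_sign.
pose F (z : {ffun I -> bool}) := expR (a * (\sum_(i <- k :: r) (-1) ^+ z i) ^+ 2).
have -> : avg F = avg (fun z => 1 / 2 * (F z + F (cube_xor z d))).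
  by rewrite avgZ avgD avg_xor; lra.
set s : R := (size r)%:R in Sle ha *.
have s0 : 0 <= s by exact: ler0n.
have as0 : 0 <= a * s by rewrite mulr_ge0.
(* By [cosh_le] the cosine factor costs [2 * (2 * a * S z) ^+ 2]. As [16 * a * s <= 1],
   [b * s <= a * (s + 1 / 2)], which preserves both the hypothesis and the bound in the
   induction. *)
pose b := a + 8 * a ^+ 2.
have b0 : 0 <= b by rewrite /b addr_ge0 // mulr_ge0 ?sqr_ge0.
have ba : b * s <= a * (s + 1 / 2).
  have : 0 <= a * (1 / 2 - 8 * (a * s)) by rewrite mulr_ge0 //; lra.
  by rewrite /b expr2; lra.
apply: (@le_trans _ _ (avg (fun z => expR a * expR (b * S z ^+ 2)))).
  apply: avg_le => z.
  rewrite /F !big_cons -/(S _) -/(S _) Sd !ffunE eqxx addbT.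
  have E (x : R) : x ^+ 2 = 1 -> expR (a * (x + S z) ^+ 2) =
      expR (a + a * S z ^+ 2) * expR (2 * a * S z * x).
    move=> x1; rewrite -expRD; congr expR.
    by transitivity (a * x ^+ 2 + a * S z ^+ 2 + 2 * a * S z * x); [ring|rewrite x1 mulr1].
  have -> : expR (a * ((-1) ^+ z k + S z) ^+ 2) + expR (a * ((-1) ^+ (~~ z k) + S z) ^+ 2)
     = expR (a + a * S z ^+ 2) * (expR (2 * a * S z) + expR (- (2 * a * S z))).
    rewrite !E ?sqrr_sign //; case: (z k) => /=;
      rewrite ?expr0 ?expr1 ?mulr1 ?mulrN1 -?mulrDr //; congr (_ * _); exact: addrC.
  have -> : expR a * expR (b * S z ^+ 2) =
      1 / 2 * (expR (a + a * S z ^+ 2) * (2 * expR (2 * (2 * a * S z) ^+ 2))).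
    transitivity (expR (a + a * S z ^+ 2) * expR (2 * (2 * a * S z) ^+ 2)); last by lra.
    by rewrite -!expRD; congr expR; rewrite /b; ring.
  apply: ler_wpM2l; first lra.
  apply: ler_wpM2l; first exact: expR_ge0.
  apply: cosh_le; rewrite !normrM ger0_norm // (ger0_norm a0).
  have : a * `|S z| <= a * s by rewrite ler_wpM2l.
  by lra.
clearbody b; rewrite avgZ; apply: (@le_trans _ _ (expR a * expR (2 * b * s))).
  apply: ler_wpM2l; first exact: expR_ge0.
  by apply: IH => //; move: ba ha; rewrite -/s; lra.
by rewrite -expRD ler_expR; lra.
Qed.

Lemma avg_expR_sqr (R : realType) (I : finType) (a : R) :
  0 <= a -> 16 * a * #|I|%:R <= 1 ->
  avg (fun z : {ffun I -> bool} => expR (a * signsum R z ^+ 2)) <= expR (2 * a * #|I|%:R).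
Proof.
have sI : size (index_enum I) = #|I| by rewrite -sum1_size -sum1_card; exact: eq_bigl.
by move=> a0; rewrite -sI; apply: avg_expR_sqr_seq => //; exact: index_enum_uniq.
Qed.

(** Exponential Markov inequality with base [9 / 8]: the tail is at most
    [(1 + q / 8) ^+ N * (8 / 9) ^+ K.+1], and [1 + q / 8 <= 17 / 16]. *)
Lemma chernoff_tail (R : realType) (I : finType) (q : R) K :
  (0 < #|I|)%N -> 0 <= q -> q <= 1 / 2 -> (17 * #|I| <= 32 * K.+1)%N ->
  1 - 17 * 32 / #|I|%:R <=
  \sum_(T : {set I}) q ^+ #|T| * (1 - q) ^+ (#|I| - #|T|) * (#|T| <= K)%N%:R.
Proof.
set N := #|I| => N0 q0 q2 NK.
pose w (T : {set I}) := q ^+ #|T| * (1 - q) ^+ (N - #|T|).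
have w0 T : 0 <= w T by rewrite mulr_ge0 ?exprn_ge0 // subr_ge0; lra.
have sw : \sum_T w T = 1 by rewrite sum_bin_weights addrCA subrr addr0 expr1n.
have -> : \sum_(T : {set I}) q ^+ #|T| * (1 - q) ^+ (N - #|T|) * (#|T| <= K)%N%:R =
    1 - \sum_T w T * (K < #|T|)%N%:R.
  rewrite -[X in _ = X - _]sw -sumrB; apply: eq_bigr => T _; rewrite -/(w T).
  by case: leqP => _; rewrite /= ?mulr1 ?mulr0 ?subr0 ?subrr.
rewrite lerD2l lerN2.
pose x : R := (17 / 16) ^+ N * (8 / 9) ^+ K.+1.
apply: (@le_trans _ _ x).
  apply: (@le_trans _ _ (\sum_(T : {set I}) (8 / 9) ^+ K.+1 *
      ((q * (9 / 8)) ^+ #|T| * (1 - q) ^+ (N - #|T|)))).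
    apply: ler_sum => T _; rewrite [(q * _) ^+ _]exprMn /w.
    have [KT|_] := ltnP K #|T|; last by rewrite mulr0 !mulr_ge0 ?exprn_ge0 //=; lra.
    rewrite mulr1 [leRHS](_ : _ = w T * ((8 / 9) ^+ K.+1 * (9 / 8) ^+ #|T|)); last first.
      by rewrite /w; ring.
    apply: ler_peMr; first exact: w0.
    rewrite -(subnK KT) exprD mulrCA -exprMn.
    rewrite (_ : 8 / 9 * (9 / 8) = 1 :> R); last by lra.
    by rewrite expr1n mulr1 exprn_ege1 //; lra.
  rewrite -mulr_sumr sum_bin_weights mulrC; apply: ler_wpM2r; first by rewrite exprn_ge0 //; lra.
  by apply: lerXn2r; rewrite ?nnegrE; lra.
have x0 : 0 <= x by rewrite mulr_ge0 ?exprn_ge0 //=; lra.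
have N0R : 0 < N%:R :> R by rewrite ltr0n.
apply: (@le_trans _ _ (expR (- (N%:R / (17 * 32))))); last first.
  have p : 0 < N%:R / (17 * 32) :> R by lra.
  rewrite expRN -(invf_div N%:R (17 * 32)) lef_pV2 ?posrE; [|exact: expR_gt0|exact: p].
  by apply: le_trans (expR_ge1Dx _); lra.
(* The 32nd power clears the fraction [17 / 32]; what remains is [(17 / 16) ^+ 32 * (8 / 9) ^+ 17 <=
   1 - 1 / 17]. *)
rewrite -(@ler_pXn2r _ 32) ?nnegrE ?expR_ge0 // -expRM_natl.
rewrite exprMn -!exprM.
apply: (@le_trans _ _ ((17 / 16) ^+ (N * 32) * (8 / 9) ^+ (17 * N))).
  apply: ler_wpM2l; first by rewrite exprn_ge0 //; lra.
  by apply: ler_wiXn2l; [lra|lra|rewrite [(K.+1 * _)%N]mulnC].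
rewrite [(N * 32)%N]mulnC !exprM -exprMn.
have -> : 32 * - (N%:R / (17 * 32)) = N%:R * - (1 / 17) :> R by lra.
rewrite expRM_natl; apply: lerXn2r; rewrite ?nnegrE ?expR_ge0 ?mulr_ge0 ?exprn_ge0 //; try lra.
by apply: le_trans (expR_ge1Dx _); lra.
Qed.

(** * Second moment *)

(** This allows two encodings of a random vector to be compared one coordinate at a time. *)
Lemma sum_pushforward (R : comNzRingType) (I A B : finType) (w : A -> R) (b : A -> B)
    (G : {ffun I -> B} -> R) :
  \sum_(r : {ffun I -> A}) (\prod_k w (r k)) * G [ffun k => b (r k)] =
  \sum_(c : {ffun I -> B}) (\prod_k \sum_(a | b a == c k) w a) * G c.
Proof.
rewrite (partition_big (fun r : {ffun I -> A} => [ffun k => b (r k)] : {ffun I -> B}) xpredT) //=.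
apply: eq_bigr => c _; rewrite bigA_distr_big_dep mulr_suml.
apply: eq_big => [r|r /eqP <-] //.
apply/eqP/familyP => [<- k|h]; first by rewrite ffunE unfold_in.
by apply/ffunP => k; rewrite ffunE; apply/eqP; have := h k; rewrite unfold_in.
Qed.

Definition bern_weight (R : nzRingType) (p : R) (b : bool) : R := if b then p else 1 - p.

Definition pair_weight (R : nzRingType) (p : R) (uv : bool * bool) : R :=
  bern_weight p uv.1 * bern_weight p uv.2.

(* [Some v] encodes a nonzero difference [u - v = (-1) ^+ v]. *)
Definition pair_diff (uv : bool * bool) : option bool :=
  if uv.1 == uv.2 then None else Some uv.2.

Definition signed_set (I : finType) (T : {set I}) (s : {ffun I -> bool}) :
  {ffun I -> option bool} := [ffun k => if k \in T then Some (s k) else None].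

Lemma sum_bool_pair (R : nmodType) (f : bool * bool -> R) :
  \sum_a f a = f (true, true) + f (true, false) + f (false, true) + f (false, false).
Proof.
rewrite (eq_bigr (fun a => f (a.1, a.2))) => [|[] //].
by rewrite -(pair_bigA _ (fun u v => f (u, v))) /= !big_bool /= addrA.
Qed.

(** A difference of two Bernoulli entries is nonzero with probability [2 * p * (1 - p)], and its
    sign is then uniform. *)
Lemma sum_pair_weight (R : realFieldType) (I : finType) (p : R)
    (G : {ffun I -> option bool} -> R) :
  \sum_(r : {ffun I -> bool * bool})
     (\prod_k pair_weight p (r k)) * G [ffun k => pair_diff (r k)] =
  \sum_(T : {set I}) (2 * p * (1 - p)) ^+ #|T| * (1 - 2 * p * (1 - p)) ^+ (#|I| - #|T|) *
     avg (fun s => G (signed_set T s)).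
Proof.
set q := 2 * p * (1 - p).
(* In this second encoding a fair sign is drawn at every index, also off the support, so that
   support and signs are independent. *)
pose w' (c : bool * bool) : R := (if c.1 then q else 1 - q) / 2.
pose b' (c : bool * bool) : option bool := if c.1 then Some c.2 else None.
transitivity (\sum_(c : {ffun I -> bool * bool}) (\prod_k w' (c k)) * G [ffun k => b' (c k)]).
  rewrite !sum_pushforward; apply: eq_bigr => c _; congr (_ * _); apply: eq_bigr => k _.
  rewrite !(big_mkcond (fun a => _ == c k)) /=.
  rewrite !sum_bool_pair /w' /b' /pair_diff /pair_weight /bern_weight /= /q.
  by case: (c k) => [[]|] /=; rewrite ?add0r ?addr0; lra.
pose h (Ts : {set I} * {ffun I -> bool}) : {ffun I -> bool * bool} :=
  [ffun k => (k \in Ts.1, Ts.2 k)].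
pose h' (c : {ffun I -> bool * bool}) : {set I} * {ffun I -> bool} :=
  ([set k | (c k).1]%SET, [ffun k => (c k).2]).
rewrite (reindex h) /=; last first.
  exists h' => [[T s] _|c _].
    congr (_, _); first by apply/setP => k; rewrite inE ffunE.
    by apply/ffunP => k; rewrite !ffunE.
  by apply/ffunP => k; rewrite !ffunE inE; case: (c k).
rewrite -(pair_bigA _ (fun T s => (\prod_k w' (h (T, s) k)) * G [ffun k => b' (h (T, s) k)])) /=.
apply: eq_bigr => T _; rewrite /avg mulrA mulr_sumr; apply: eq_bigr => s _.
congr (_ * G _); last by apply/ffunP => k; rewrite !ffunE.
rewrite /w' big_split /= prodr_const -exprVn; congr (_ * _).
rewrite (bigID (mem T)) /= (eq_bigr (fun=> q)) => [|k kT]; last by rewrite ffunE /= kT.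
rewrite [X in _ * X = _](eq_bigr (fun=> 1 - q)) => [|k /negbTE kT]; last by rewrite ffunE /= kT.
rewrite !prodr_const; congr (_ * _ ^+ _).
by rewrite -(cardsC T) addKn; apply: eq_card => k; rewrite !inE.
Qed.

Definition diff_psi (R : realFieldType) (I : finType) K (x : {ffun I -> bool})
    (c : {ffun I -> option bool}) : R :=
  psi R K [set k | c k]%SET (cube_xor [ffun k => odflt false (c k)] x).

Lemma balanced_ext (I : finType) (T : {set I}) (s s' : {ffun I -> bool}) :
  {in T, s =1 s'} -> balanced T s = balanced T s'.
Proof.
move=> ss'; rewrite /balanced; suff -> : ones T s = ones T s' by [].
by apply: eq_bigr => k kT; rewrite ss'.
Qed.

Lemma diff_psi_signed_set (R : realFieldType) (I : finType) K x (T : {set I}) s :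
  diff_psi R K x (signed_set T s) = psi R K T (cube_xor s x).
Proof.
rewrite /diff_psi; have -> : [set k | signed_set T s k]%SET = T.
  by apply/setP => k; rewrite inE ffunE; case: ifP.
rewrite /psi; congr (if _ then _ * (nat_of_bool _)%:R else _); apply: balanced_ext => k kT.
by rewrite !ffunE kT.
Qed.

Definition trunc_mass (R : realFieldType) (I : finType) K (q : R) : R :=
  \sum_(T : {set I}) q ^+ #|T| * (1 - q) ^+ (#|I| - #|T|) * (#|T| <= K)%N%:R.

Lemma sum_diff_psi (R : realFieldType) (I : finType) (p : R) K (x : {ffun I -> bool}) :
  \sum_(r : {ffun I -> bool * bool})
     (\prod_k pair_weight p (r k)) * diff_psi R K x [ffun k => pair_diff (r k)] =
  trunc_mass I K (2 * p * (1 - p)).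
Proof.
rewrite sum_pair_weight; apply: eq_bigr => T _; congr (_ * _).
rewrite (@avg_ext _ _ _ (fun s => psi R K T (cube_xor s x))) ?avg_xor ?avg_psi // => s.
exact: diff_psi_signed_set.
Qed.

(** Translating the uniform signs of the row by [x] leaves only the product of [x] and [y]. *)
Lemma sum_diff_psi2 (R : realFieldType) (I : finType) (p : R) K (x y : {ffun I -> bool}) :
  \sum_(r : {ffun I -> bool * bool}) (\prod_k pair_weight p (r k)) *
     (diff_psi R K x [ffun k => pair_diff (r k)] * diff_psi R K y [ffun k => pair_diff (r k)]) =
  corr K (2 * p * (1 - p)) (cube_xor x y).
Proof.
rewrite (sum_pair_weight p (fun c => diff_psi R K x c * diff_psi R K y c)).
apply: eq_bigr => T _; congr (_ * _).
rewrite -(avg_xor (fun s => psi R K T s * psi R K T (cube_xor s (cube_xor x y))) x).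
apply: avg_ext => s; rewrite !diff_psi_signed_set; congr (_ * psi R K T _).
by apply/ffunP => k; rewrite !ffunE; case: (s k); case: (x k); case: (y k).
Qed.

Definition rowsum (R : realFieldType) (I : finType) (x : {ffun I -> bool})
    (r : {ffun I -> bool * bool}) : R :=
  \sum_k (-1) ^+ x k * ((r k).1%:R - (r k).2%:R).

Definition good_rows (R : realFieldType) (J I : finType)
    (M : {ffun J -> {ffun I -> bool * bool}}) : bool :=
  [exists x : {ffun I -> bool}, [forall i, `|rowsum R x (M i)| <= 1]].

Lemma diff_psi_rowsum (R : realFieldType) (I : finType) K (x : {ffun I -> bool})
    (r : {ffun I -> bool * bool}) :
  diff_psi R K x [ffun k => pair_diff (r k)] != 0 -> `|rowsum R x r| <= 1.
Proof.
rewrite /diff_psi /psi; set T := [set k | _]%SET; set s := cube_xor _ _.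
have -> : rowsum R x r = \sum_(k in T) (-1) ^+ s k.
  rewrite [RHS]big_mkcond; apply: eq_bigr => k _.
  rewrite inE !ffunE /pair_diff; case: (r k) => [[] []]; case: (x k);
    by rewrite /= ?expr0 ?expr1; lra.
rewrite balancedP; case: ifP => _; last by rewrite eqxx.
by case: (balanced T s) => //; rewrite mulr0 eqxx.
Qed.

(* The second moment method in the form [1_(Z > 0) >= 2 Z - Z ^+ 2]. *)
Lemma good_rows_moments (R : realFieldType) (J I : finType) (p : R) K : 0 <= p -> p <= 1 ->
  2 * trunc_mass I K (2 * p * (1 - p)) ^+ #|J|
    - avg (fun z : {ffun I -> bool} => corr K (2 * p * (1 - p)) z ^+ #|J|) <=
  \sum_(M : {ffun J -> {ffun I -> bool * bool}})
     (\prod_i \prod_k pair_weight p (M i k)) * (good_rows R M)%:R.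
Proof.
move=> p0 p1; set q := 2 * p * (1 - p).
pose D x (r : {ffun I -> bool * bool}) := diff_psi R K x [ffun k => pair_diff (r k)].
pose Z (M : {ffun J -> {ffun I -> bool * bool}}) := avg (fun x => \prod_i D x (M i)).
pose W (M : {ffun J -> {ffun I -> bool * bool}}) : R := \prod_i \prod_k pair_weight p (M i k).
have W0 M : 0 <= W M.
  apply: prodr_ge0 => i _; apply: prodr_ge0 => k _; apply: mulr_ge0;
    by rewrite /bern_weight; case: ifP; rewrite ?subr_ge0.
have avg_sum (F : {ffun J -> {ffun I -> bool * bool}} -> {ffun I -> bool} -> R) :
    avg (fun y => \sum_M W M * F M y) = \sum_M W M * avg (F M).
  rewrite /avg exchange_big mulr_sumr; apply: eq_bigr => M _.
  by rewrite -mulr_sumr mulrCA.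
have E1 : \sum_M W M * Z M = trunc_mass I K q ^+ #|J|.
  rewrite -avg_sum.
  rewrite -[RHS](@avg_const _ I); apply: avg_ext => x.
  under eq_bigr do rewrite /W -big_split /=.
  rewrite -(bigA_distr_bigA (fun (i : J) (r : {ffun I -> bool * bool}) =>
    (\prod_k pair_weight p (r k)) * D x r)) /=.
  by rewrite -prodr_const; apply: eq_bigr => i _; exact: sum_diff_psi.
have E2 : \sum_M W M * Z M ^+ 2 = avg (fun z : {ffun I -> bool} => corr K q z ^+ #|J|).
  transitivity (avg (fun x : {ffun I -> bool} => avg (fun y : {ffun I -> bool} =>
      \sum_M W M * \prod_i (D x (M i) * D y (M i))))).
    under [RHS]avg_ext do rewrite avg_sum; rewrite avg_sum; apply: eq_bigr => M _.
    congr (_ * _); rewrite expr2 {1}/Z mulrC -avgZ; apply: avg_ext => x.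
    rewrite mulrC -avgZ; apply: avg_ext => y; rewrite big_split.
    by [].
  rewrite -[RHS](@avg_const _ I); apply: avg_ext => x.
  rewrite -(avg_xor (fun z => corr K q z ^+ #|J|) x); apply: avg_ext => y.
  under eq_bigr do rewrite /W -big_split /=.
  rewrite -(bigA_distr_bigA (fun (i : J) (r : {ffun I -> bool * bool}) =>
    (\prod_k pair_weight p (r k)) * (D x r * D y r))) /=.
  by rewrite -prodr_const; apply: eq_bigr => i _; rewrite cube_xorC; exact: sum_diff_psi2.
rewrite -E1 -E2 mulr_sumr -sumrB; apply: ler_sum => M _; rewrite -/(W M).
rewrite mulrCA -mulrBr; apply: ler_wpM2l => //.
have [gM|] := boolP (good_rows R M).
  by rewrite /= -subr_ge0 (_ : 1%:R - _ = (1 - Z M) ^+ 2) ?sqr_ge0 //; ring.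
(* If no signing is good, each product has a zero factor, so [Z M = 0]. *)
rewrite negb_exists => /forallP bad.
rewrite /Z (@avg_ext _ _ _ (fun=> 0)) ?avg_const ?mulr0 ?expr2 ?mulr0 ?subrr // => x.
have := bad x; rewrite negb_forall => /existsP[i ri].
have /eqP D0 : D x (M i) == 0 by apply: contraNT ri => /diff_psi_rowsum.
by rewrite (bigD1 i) //= D0 mul0r.
Qed.

(** The first term handles [|S| <= N / 20] through [decay_sum]. Otherwise [corr] is at most [N + 1],
    and the last two exponentials have product at least 1 because
    [S ^+ 2 / (16 * N) >= N / 6400]. *)
Lemma corr_pow_le (R : realType) (I : finType) m (q : R) (z : {ffun I -> bool}) :
  0 <= q -> q <= 1 -> (32 <= #|I|)%N ->
  corr (17 * #|I| %/ 32) q z ^+ m <=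
  expR (68 * (m%:R / #|I|%:R)) * expR (68 * m%:R / #|I|%:R ^+ 2 * signsum R z ^+ 2) +
  #|I|.+1%:R ^+ m * expR (- (#|I|%:R / (80 * 80))) *
    expR ((16 * #|I|%:R)^-1 * signsum R z ^+ 2).
Proof.
move=> q0 q1 N32; set N := #|I| in N32 *; set K := (17 * N %/ 32)%N.
have KN : (32 * K <= 17 * N)%N by rewrite mulnC leq_divM.
have cle := corr_le z q0 q1 (_ : K <= N)%N.
have {}cle := cle ltac:(lia).
have c0 := corr_ge0 K z q0 q1.
have NR : 32 <= N%:R :> R by rewrite (ler_nat _ 32).
have Nn0 : N%:R != 0 :> R by rewrite gt_eqF //; lra.
have [smallS|largeS] := leP (20 * `|signsum R z|) N%:R.
  have ds : \sum_(2 <= j < K.+1) `|kappa R j z| <= 68 * (signsum R z ^+ 2 / N%:R ^+ 2 + N%:R^-1).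
    apply: (@decay_sum R N (signsum R z) (fun j => kappa R j z)) => //.
    - by move=> j jN; exact: kappa_rec.
    - exact: kappa0.
    - exact: kappa1.
    - by rewrite /K; lia.
  apply: ler_wpDr; first by rewrite !mulr_ge0 ?exprn_ge0 ?expR_ge0.
  rewrite -expRD; set e := (X in 68 * X) in ds.
  have -> : 68 * (m%:R / N%:R) + 68 * m%:R / N%:R ^+ 2 * signsum R z ^+ 2 = m%:R * (68 * e).
    by rewrite /e; field.
  rewrite expRM_natl; apply: lerXn2r; rewrite ?nnegrE ?expR_ge0 //.
  by apply: le_trans (expR_ge1Dx _); lra.
apply: ler_wpDl; first by rewrite !mulr_ge0 ?expR_ge0.
rewrite -mulrA -expRD; apply: (@le_trans _ _ (N.+1%:R ^+ m)).
  apply: lerXn2r; rewrite ?nnegrE //; apply: le_trans cle _.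
  rewrite -natr1 addrC lerD2r.
  apply: (@le_trans _ _ (\sum_(2 <= j < K.+1) 1)).
    by apply: ler_sum => j _; exact: normr_kappa_le1.
  by rewrite sumr_const_nat ler_nat; lia.
apply: ler_peMr; first by rewrite exprn_ge0.
apply: le_trans (expR_ge1Dx _); rewrite lerDl addrC subr_ge0.
have : N%:R ^+ 2 <= (20 * signsum R z) ^+ 2.
  rewrite -[leRHS]real_normK ?num_real //.
  by apply: lerXn2r; rewrite ?nnegrE // normrM ger0_norm; lra.
have N0 : 0 < N%:R :> R by lra.
have p : 0 < (16 * N%:R)^-1 :> R by rewrite invr_gt0; lra.
rewrite -(ler_pM2l p).
have -> : N%:R / (80 * 80) = (16 * N%:R)^-1 * (N%:R ^+ 2 / 400) :> R by field.
by rewrite !(ler_pM2l p); lra.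
Qed.

(** [avg_expR_sqr] is applied with [a = 68 * m / N ^+ 2], where [16 * a * N <= 1] reads
    [32 * 34 * m <= N] and [204 = 68 + 2 * 68], and with [a = (16 * N)^-1], which gives the
    [1 / 8]. *)
Lemma avg_corr_pow (R : realType) (I : finType) m (q : R) :
  0 <= q -> q <= 1 -> (32 * 34 * m <= #|I|)%N -> (0 < m)%N ->
  avg (fun z : {ffun I -> bool} => corr (17 * #|I| %/ 32) q z ^+ m) <=
  expR (204 * (m%:R / #|I|%:R)) +
  #|I|.+1%:R ^+ m * expR (1 / 8 - #|I|%:R / (80 * 80)).
Proof.
move=> q0 q1 mN m0; have N32 : (32 <= #|I|)%N by lia.
apply: le_trans (avg_le _) _.
  by move=> z; exact: (corr_pow_le m z q0 q1 N32).
set N := #|I| in mN N32 *.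
have NR : 32 <= N%:R :> R by rewrite (ler_nat _ 32).
have mNR : 32 * 34 * m%:R <= N%:R :> R by rewrite -!natrM ler_nat.
have Nn0 : N%:R != 0 :> R by rewrite gt_eqF //; lra.
have N0 : 0 < N%:R :> R by lra.
rewrite avgD !avgZ; apply: lerD.
  apply: (@le_trans _ _ (expR (68 * (m%:R / N%:R)) *
      expR (2 * (68 * m%:R / N%:R ^+ 2) * N%:R))).
    apply: ler_wpM2l; first exact: expR_ge0.
    apply: avg_expR_sqr; first by rewrite !mulr_ge0 ?invr_ge0 ?exprn_ge0.
    rewrite -/N (_ : _ * N%:R = 32 * 34 * m%:R / N%:R); last by field.
    by rewrite ler_pdivrMr // mul1r.
  rewrite -expRD ler_expR le_eqVlt; apply/orP; left; apply/eqP.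
  by field.
rewrite -mulrA; apply: ler_wpM2l; first by rewrite exprn_ge0.
rewrite addrC expRD; apply: ler_wpM2l; first exact: expR_ge0.
have -> : 1 / 8 = 2 * (16 * N%:R)^-1 * N%:R :> R by field.
apply: avg_expR_sqr; first by rewrite invr_ge0; lra.
by rewrite -/N le_eqVlt; apply/orP; left; apply/eqP; field.
Qed.

Lemma bernoulli_ineq (R : realDomainType) (x : R) m : -1 <= x -> 1 + m%:R * x <= (1 + x) ^+ m.
Proof.
move=> x1; elim: m => [|m IH]; first by rewrite mul0r addr0 expr0.
rewrite exprS -natr1; apply: (@le_trans _ _ ((1 + x) * (1 + m%:R * x))); last first.
  by apply: ler_wpM2l => //; lra.
have : 0 <= m%:R * x ^+ 2 by rewrite mulr_ge0 ?sqr_ge0.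
by rewrite expr2; lra.
Qed.

Lemma good_rows_prob (R : realType) (J I : finType) (p : R) :
  0 <= p -> p <= 1 -> (0 < #|J|)%N -> (32 * 34 * #|J| <= #|I|)%N ->
  #|J|%:R * ln (#|I|.+1%:R : R) <= #|I|%:R / (2 * 80 * 80) ->
  1 - 31 * 30 * 30 * (#|J|%:R / #|I|%:R) <=
  \sum_(M : {ffun J -> {ffun I -> bool * bool}})
     (\prod_i \prod_k pair_weight p (M i k)) * (good_rows R M)%:R.
Proof.
move=> p0 p1; set m := #|J|; set N := #|I| => m0 mN hln.
set q := 2 * p * (1 - p).
have q0 : 0 <= q by rewrite !mulr_ge0 ?subr_ge0.
have q2 : q <= 1 / 2.
  by have := sqr_ge0 (2 * p - 1); rewrite /q expr2; lra.
have q1 : q <= 1 by lra.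
apply: le_trans (good_rows_moments J I (17 * N %/ 32) p0 p1).
rewrite -/q -/m.
have N0 : (0 < N)%N by lia.
have ac := avg_corr_pow q0 q1 mN m0; rewrite -/N in ac.
have ct : 1 - 17 * 32 / N%:R <= trunc_mass I (17 * N %/ 32) q.
  by apply: chernoff_tail => //; rewrite -/N; lia.
have mR : 1 <= m%:R :> R by rewrite ler1n.
have mNR : 32 * 34 * m%:R <= N%:R :> R by rewrite -!natrM ler_nat.
have NR0 : 0 < N%:R :> R by rewrite ltr0n.
have small : 17 * 32 / N%:R <= 1 :> R by rewrite ler_pdivrMr //; lra.
have tm : 1 - 17 * 32 * (m%:R / N%:R) <= trunc_mass I (17 * N %/ 32) q ^+ m.
  apply: (@le_trans _ _ ((1 - 17 * 32 / N%:R) ^+ m)).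
    apply: le_trans (bernoulli_ineq m _); last by lra.
    by rewrite mulrN mulrCA.
  by apply: lerXn2r => //; rewrite nnegrE; lra.
set eta := m%:R / N%:R in tm ac *.
have etaN : N%:R^-1 <= eta by rewrite /eta ler_peMl // invr_ge0 ltW.
have eta0 : 0 <= eta by rewrite /eta divr_ge0.
have etaS : 32 * 34 * eta <= 1 by rewrite /eta mulrA ler_pdivrMr // mul1r.
have e1 : expR (204 * eta) <= 1 + 408 * eta.
  apply: le_trans (expR_le_quadratic _) _; first by lra.
  have : 0 <= eta * (1 - 408 * eta) by apply: mulr_ge0; lra.
  by rewrite expr2; lra.
(* By [hln], half of the exponent [N / 6400] absorbs [N.+1 ^+ m]; the other half gives a multiple of
   [1 / N], hence of [eta]. *)
have e2 : N.+1%:R ^+ m * expR (1 / 8 - N%:R / (80 * 80)) <= 26 * 30 * 33 * eta.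
  have -> : N.+1%:R ^+ m = expR (m%:R * ln (N.+1%:R : R)).
    by rewrite expRM_natl lnK // posrE.
  rewrite -expRD; apply: (@le_trans _ _ (expR (1 / 8) * (expR (N%:R / (2 * 80 * 80)))^-1)).
    by rewrite -expRN -expRD ler_expR; lra.
  have h8 : expR (1 / 8) <= 2 :> R.
    by apply: le_trans (expR_le_quadratic _) _; rewrite ?expr2; lra.
  have hN : (expR (N%:R / (2 * 80 * 80)))^-1 <= 2 * 80 * 80 * eta.
    apply: (@le_trans _ _ (N%:R / (2 * 80 * 80))^-1).
      rewrite lef_pV2 ?posrE ?expR_gt0 //; last by lra.
      by apply: le_trans (expR_ge1Dx _); lra.
    by rewrite invf_div; lra.
  apply: (@le_trans _ _ (2 * (2 * 80 * 80 * eta))); last by lra.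
  by apply: ler_pM => //; rewrite ?invr_ge0 ?expR_ge0.
by lra.
Qed.

(** * Random matrices *)

Definition entry (m N : nat) (M : {ffun 'I_m -> {ffun 'I_N -> bool * bool}})
    (i : 'I_m) (j : 'I_(N + N)) : bool :=
  match fintype.split j with inl k => (M i k).1 | inr k => (M i k).2 end.

Lemma entry_lshift m N (M : {ffun 'I_m -> {ffun 'I_N -> bool * bool}}) i k :
  entry M i (lshift N k) = (M i k).1.
Proof. by rewrite /entry (unsplitK (inl k)). Qed.

Lemma entry_rshift m N (M : {ffun 'I_m -> {ffun 'I_N -> bool * bool}}) i k :
  entry M i (rshift N k) = (M i k).2.
Proof. by rewrite /entry (unsplitK (inr k)). Qed.

(* Columns [k] and [N + k] get opposite signs. *)
Lemma disc_good_rows (R : realType) m N (M : {ffun 'I_m -> {ffun 'I_N -> bool * bool}}) :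
  good_rows R M -> disc (\matrix_(i, j) (entry M i j)%:R : 'M[R]_(m, N + N)) <= 1.
Proof.
move=> /existsP[x /forallP xM].
pose u : 'cV[R]_(N + N) :=
  \col_j match fintype.split j with inl k => (-1) ^+ x k | inr k => - (-1) ^+ x k end.
have su : sign_vectors R (N + N) u.
  move=> j; rewrite mxE; case: (fintype.split j) => k; case: (x k);
    rewrite ?expr0 ?expr1 ?opprK; by [left|right].
apply: le_trans (disc_le _ su) _.
rewrite /Num.Def.normr /= mx_normrE; apply: bigmax_le => // -[i k] _ /=.
rewrite ord1 mxE; suff -> : \sum_j (\matrix_(i, j) (entry M i j)%:R : 'M[R]_(m, N + N)) i j * u j 0 =
    rowsum R x (M i) by [].
rewrite big_split_ord /= -big_split; apply: eq_bigr => l _ /=.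
rewrite !mxE entry_lshift entry_rshift (unsplitK (inl l)) (unsplitK (inr l)); ring.
Qed.

Section Probability.
Variables (R : realType) (d : measure_display) (T : measurableType d) (P : probability T R).
Variables (m N : nat) (p : R) (X : 'I_m -> 'I_(N + N) -> {RV P >-> bool}).
Hypothesis p01 : 0 <= p <= 1.
Hypothesis iidX : iid_bernoulli p X.

Let rows := {ffun 'I_m -> {ffun 'I_N -> bool * bool}}.

Let ev (M : rows) : set T :=
  \bigcap_(ij in [set` [set: 'I_m * 'I_(N + N)]%SET])
    (X ij.1 ij.2 @^-1` [set entry M ij.1 ij.2]).

Let evP (M : rows) t : ev M t <-> forall i j, X i j t = entry M i j.
Proof.
split=> [h i j|h [i j] _] /=; last exact: h.
by apply: (h (i, j)); rewrite /= inE.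
Qed.

Let measurable_ev (M : rows) : measurable (ev M).
Proof.
apply: fin_bigcap_measurable; first exact: finite_finset.
by move=> ij _; rewrite -[X in measurable X]setTI; exact: measurable_funP.
Qed.

Let prob_ev (M : rows) : P (ev M) = (\prod_i \prod_k pair_weight p (M i k))%:E.
Proof.
rewrite /ev iidX.1; last by [].
have E ij : P (X ij.1 ij.2 @^-1` [set entry M ij.1 ij.2]) =
    (bern_weight p (entry M ij.1 ij.2))%:E.
  have := iidX.2 ij.1 ij.2 [set entry M ij.1 ij.2].
  rewrite /distribution /pushforward => ->.
  by rewrite /bernoulli_prob p01 fsbig_set1 /bernoulli_pmf /bern_weight.
rewrite (eq_bigr _ (fun ij _ => E ij)).
rewrite prodEFin; congr (_%:E).
rewrite (eq_bigl xpredT) => [|ij]; last by rewrite inE.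
rewrite -(pair_bigA _ (fun i j => bern_weight p (entry M i j))) /=.
apply: eq_bigr => i _; rewrite big_split_ord /= -big_split; apply: eq_bigr => k _ /=.
by rewrite entry_lshift entry_rshift.
Qed.

Let D : set rows :=
  [set M | disc (\matrix_(i, j) (entry M i j)%:R : 'M[R]_(m, N + N)) <= 1].

(** The random matrix takes finitely many values; this also yields measurability of the event. *)
Let disc_eventE : [set t | disc (random_matrix X t) <= 1] = \bigcup_(M in D) ev M.
Proof.
  apply/seteqP; split=> t /=.
    move=> dt; pose M : rows := [ffun i => [ffun k => (X i (lshift N k) t, X i (rshift N k) t)]].
    have XM i j : X i j t = entry M i j.
      by rewrite /entry -[in LHS](fintype.splitK j); case: (fintype.split j) => k /=; rewrite !ffunE.
    exists M; last by apply/evP.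
    rewrite /D /= (_ : \matrix_(_, _) _ = random_matrix X t) //.
    by apply/matrixP => i j; rewrite !mxE XM.
  move=> [M dM /evP XM]; rewrite (_ : random_matrix X t = \matrix_(i, j) (entry M i j)%:R) //.
  by apply/matrixP => i j; rewrite !mxE XM.
Qed.

Lemma measurable_disc_le1 : measurable [set t | disc (random_matrix X t) <= 1].
Proof.
by rewrite disc_eventE; apply: fin_bigcup_measurable => //; exact: finite_finset.
Qed.

(** The events [ev M] are disjoint, so the sum is the probability of the union over good [M],
    contained in the event by [disc_good_rows]. *)
Lemma prob_disc_ge :
  ((\sum_(M : rows) (\prod_i \prod_k pair_weight p (M i k)) * (good_rows R M)%:R)%:E
   <= P [set t | (disc (random_matrix X t) <= 1)%R])%E.
Proof.
pose G : set rows := [set M | good_rows R M].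
have trivE (A : set rows) : trivIset A ev.
  move=> M M' _ _ [t [/evP h /evP h']]; apply/ffunP => i; apply/ffunP => k.
  have := h i (lshift N k); have := h i (rshift N k).
  rewrite h' h' !entry_lshift !entry_rshift.
  by case: (M i k) (M' i k) => [a b] [a' b'] /= -> ->.
have -> : (\sum_(M : rows) (\prod_i \prod_k pair_weight p (M i k)) * (good_rows R M)%:R)%:E
    = P (\bigcup_(M in G) ev M).
  rewrite measure_fin_bigcup //; last exact: finite_finset.
  rewrite (_ : G = [set` enum [pred M | good_rows R M]]); last first.
    by apply/seteqP; split=> M /=; rewrite mem_enum inE.
  rewrite -fsbig_seq ?enum_uniq // big_enum /= -sumEFin [RHS]big_mkcond.
  apply: eq_bigr => M _; rewrite inE.
  by case: ifP => _; rewrite ?mulr1 ?mulr0 // prob_ev.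
rewrite disc_eventE; apply: le_measure; rewrite ?inE.
- by apply: fin_bigcup_measurable => //; exact: finite_finset.
- by apply: fin_bigcup_measurable => //; exact: finite_finset.
- by move=> t [M DM XM]; exists M => //; exact: disc_good_rows.
Qed.

End Probability.

(** * Choice of the constant and passage to the limit *)

(** As [N] has no upper bound in terms of [m], two ranges are needed. If [N.+1 <= m ^+ 3], the
    logarithm is at most [3 * ln m]. Otherwise the cube root [w] of [N.+1] exceeds [m], and the left
    side is at most [3 * w ^+ 2], small against [w ^+ 3]. *)
Lemma ln_bound (R : realType) (m N : nat) :
  100 * 100 * 8 <= m%:R :> R -> 0 <= ln (m%:R : R) ->
  100 * 100 * 8 * (m%:R * ln (m%:R : R)) <= N%:R ->
  m%:R * ln (N.+1%:R : R) <= N%:R / (2 * 80 * 80).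
Proof.
move=> mbig lnm hN.
have m0 : 0 < m%:R :> R by lra.
have NR : N.+1%:R = N%:R + 1 :> R by rewrite natr1.
have N1 : 0 < N.+1%:R :> R by rewrite ltr0n.
have [small|large] := leP (N.+1%:R : R) (m%:R ^+ 3).
  have : ln (N.+1%:R : R) <= 3 * ln (m%:R : R).
    rewrite mulr_natl -lnXn // ler_ln ?posrE ?exprn_gt0 //.
  move=> /(ler_wpM2l (ltW m0)) h; apply: le_trans h _.
  by have := mulr_ge0 (ltW m0) lnm; lra.
pose w : R := expR (ln N.+1%:R / 3).
have w3 : w ^+ 3 = N.+1%:R.
  by rewrite /w -expRM_natl mulrC divfK // lnK ?posrE.
have mw : m%:R <= w.
  by rewrite -(@ler_pXn2r _ 3) ?nnegrE ?expR_ge0 ?ltW // w3.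
have w0 : 0 < w by exact: expR_gt0.
have lw : ln (N.+1%:R : R) <= 3 * w.
  have := expR_ge1Dx (ln (N.+1%:R : R) / 3); rewrite -/w; lra.
apply: (@le_trans _ _ (w * (3 * w))).
  by apply: ler_pM => //; rewrite ?ln_ge0 ?ler1n // ltW.
have -> : N%:R = w ^+ 3 - 1 by rewrite w3 NR; lra.
have h1 : 0 <= w * w * (w - 100 * 100 * 8).
  by apply: mulr_ge0; [exact: mulr_ge0 (ltW w0) (ltW w0)|lra].
have h2 : 1 <= w * w.
  by rewrite -[leLHS]mulr1; apply: ler_pM => //; lra.
by rewrite !exprS expr0; lra.
Qed.

Theorem theorem1 (R : realType) :
  exists C : R, 0 < C /\
  forall (n : nat -> nat) (p : nat -> R),
    (forall m : nat, (0 < m)%N ->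
       ~~ odd (n m) /\ C * m%:R * ln m%:R <= (n m)%:R) ->
    (forall k : nat, 0 <= p k <= 1) ->
  forall (d : nat -> measure_display) (T : forall m, measurableType (d m))
    (P : forall m, probability (T m) R)
    (X : forall m, 'I_m -> 'I_(n m) -> {RV (P m) >-> bool}),
    (forall m, iid_bernoulli (p (n m)) (X m)) ->
    (fun m => P m [set t | disc (random_matrix (X m) t) <= 1]) @ \oo --> 1%E.
Proof.
(* The factor 2 accounts for [n = 2N]; then [N >= 80000 * m * ln m] makes the error
   [31 * 30 * 30 * m / N] at most [1 / ln m]. *)
exists (2 * (100 * 100 * 8)); split; first by lra.
move=> n p hn p01 d T P X iid.
have key m : (0 < m)%N -> measurable [set t | disc (random_matrix (X m) t) <= 1] /\
    (100 * 100 * 8 <= m%:R :> R -> 1 <= ln (m%:R : R) ->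
     ((1 - (ln m%:R)^-1)%:E <= P m [set t | (disc (random_matrix (X m) t) <= 1)%R])%E).
  move=> m0; have [en] := hn m m0.
  have nE : n m = ((n m)./2 + (n m)./2)%N by rewrite addnn -[LHS]odd_double_half (negbTE en).
  (* The type of [X m] depends on [n m], so it is generalized before [n m] is replaced by
     [N + N]. *)
  move: (X m) (iid m) (p01 (n m)); rewrite {en}nE; move: ((n m)./2) => N.
  move: (p _) => {}p {}X {}iid {}p01 hN; split; first exact: measurable_disc_le1.
  move=> mbig ln1; apply: le_trans (prob_disc_ge p01 iid).
  have mR : 0 < m%:R :> R by rewrite ltr0n.
  have {}hN : 100 * 100 * 8 * (m%:R * ln (m%:R : R)) <= N%:R.
    by move: hN; rewrite natrD; lra.
  have mN : 100 * 100 * 8 * m%:R <= N%:R :> R.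
    apply: le_trans hN; have : m%:R <= m%:R * ln (m%:R : R) by rewrite ler_peMr // ltW.
    by lra.
  have /andP[p0 p1] := p01.
  have NR : 0 < N%:R :> R by lra.
  have := @good_rows_prob R 'I_m 'I_N p p0 p1.
  rewrite !card_ord => /(_ m0) good; rewrite lee_fin; apply: le_trans (good _ _).
  - rewrite lerD2l lerN2 mulrA ler_pdivrMr //.
    have l0 : 0 < ln (m%:R : R) by lra.
    rewrite [leRHS]mulrC ler_pdivlMr //.
    by have := mulr_gt0 mR l0; lra.
  - by rewrite -(ler_nat R) !natrM; lra.
  - by apply: ln_bound => //; lra.
apply: (@squeeze_cvge _ _ _ _ (fun m => (1 - (ln m%:R)^-1)%:E) _ (fun=> 1%E)).
- near=> m.
  have m0 : (0 < m)%N by near: m; exact: nbhs_infty_gt.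
  have [mD ge] := key m m0; rewrite probability_le1 // andbT; apply: ge.
    by near: m; exact: nbhs_infty_ger.
  rewrite -[leLHS](expRK (1 : R)) ler_ln ?posrE ?expR_gt0 ?ltr0n //.
  by near: m; exact: nbhs_infty_ger.
- rewrite -[X in _ --> X](_ : (1 - 0)%:E = 1%E); last by rewrite subr0.
  apply: cvg_EFin; first by near=> m.
  apply: cvgB; first exact: cvg_cst.
  apply/cvgrPdist_le => e e0; near=> m.
  have m0 : (0 < m)%N by near: m; exact: nbhs_infty_gt.
  have le : e^-1 <= ln (m%:R : R).
    rewrite -[leLHS]expRK ler_ln ?posrE ?expR_gt0 ?ltr0n //.
    by near: m; exact: nbhs_infty_ger.
  have ei : 0 < e^-1 by rewrite invr_gt0.
  rewrite sub0r normrN ger0_norm; last by rewrite invr_ge0; lra.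
  by rewrite -[leRHS]invrK lef_pV2 // posrE; lra.
- exact: cvg_cst.
Unshelve. all: by end_near.
Qed.
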